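(* Let $\phi:B_E\to B_E$ be analytic. Assume that (i) for every $0<\delta<1$ the sets $\{\phi(z): z\in B_E,\ \|\phi(z)\|\le \delta\}$ and $\{(1-\|z\|^2)\mathcal R\phi(z): z\in B_E,\ \|\phi(z)\|\le \delta\}$ are relatively compact in $E$; (ii) $\displaystyle\lim_{\|\phi(z)\|\to 1}\frac{(1- \|z\|^2) \|\mathcal R \phi(z)\|}{\sqrt{1- \|\phi(z)\|^2}}=0$; and (iii) $\displaystyle\lim_{\|\phi(z)\|\to 1}\frac{(1- \|z\|^2) |\langle \phi(z), \mathcal R\phi(z)\rangle|}{1- \|\phi(z)\|^2}=0$. Then the composition operator $C_\phi:\mathcal B(B_E)\to \mathcal B(B_E)$, $C_\phi f=f\circ\phi$, is compact.
   Context: $E$ is a complex Hilbert space of arbitrary dimension with inner product $\langle\cdot,\cdot\rangle$ (linear in the first variable) and open unit ball $B_E$. For an analytic map $\phi:B_E\to E$, $\phi'(x)$ denotes its (Fréchet) derivative at $x$ and $\mathcal R\phi(x)=\phi'(x)(x)$ its radial derivative. A limit $\lim_{\|\phi(z)\|\to 1} Q(z)=0$ means: for every $\varepsilon>0$ there is $r<1$ such that $|Q(z)|<\varepsilon$ for all $z\in B_E$ with $\|\phi(z)\|>r$. The Bloch space $\mathcal B(B_E)$ is the space of analytic $f:B_E\to\mathbb C$ with $\|f\|_{\mathcal B(B_E)}=\sup_{x\in B_E}(1-\|x\|^2)\|f'(x)\|<\infty$; it is a Banach space with the norm $\|f\|_{Bloch(B_E)}=|f(0)|+\|f\|_{inv}$,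 where $\|f\|_{inv}=\sup_{x\in B_E}\|\nabla(f\circ\varphi_x)(0)\|$ is an equivalent seminorm; here $\nabla g(x)\in E$ is defined by $g'(x)(y)=\langle y,\overline{\nabla g(x)}\rangle$ with $\overline{z}=\sum_k\overline{z_k}e_k$ for $z=\sum_k z_ke_k$ in a fixed orthonormal basis $(e_k)$, and $\varphi_a$ ($a\in B_E$) is the Möbius automorphism $\varphi_a(x)=(s_aQ_a+P_a)\big(\frac{a-x}{1-\langle x,a\rangle}\big)$, $s_a=\sqrt{1-\|a\|^2}$, $P_a$ the orthogonal projection onto $\mathbb C a$, $Q_a=I-P_a$ (with $\varphi_0(x)=-x$). *)

(* Defs.v *)
From mathcomp Require Import all_boot all_algebra.
From mathcomp Require Import complex.
From mathcomp Require Import all_classical all_reals all_analysis.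
Import numFieldNormedType.Exports.
Import GRing.Theory Num.Theory.

Set Implicit Arguments.
Unset Strict Implicit.
Unset Printing Implicit Defensive.

Local Open Scope ring_scope.
Local Open Scope classical_set_scope.

Section Hilbert.
Variable R : realType.
Local Notation C := (R[i])%C.

Definition is_inner_product (E : completeNormedModType C) (ip : E -> E -> C) :=
  [/\ forall (a : C) (x1 x2 y : E), ip (a *: x1 + x2) y = a * ip x1 y + ip x2 y,
      forall x y : E, ip y x = (ip x y)^* &
      forall x : E, `|x| ^+ 2 = ip x x].

Definition unit_ball (E : completeNormedModType C) : set (CompleteNormedModule.sort E) := [set x | `|x| < 1].
Arguments unit_ball : clear implicits.


Definition functional_norm (E : completeNormedModType C) (L : E -> C^o) : \bar R :=
  ereal_sup [set (complex.Re `|L y|)%:E | y in [set y : E | `|y| <= 1]].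

Definition bloch_seminorm (E : completeNormedModType C) (f : E -> C^o) : \bar R :=
  ereal_sup [set ((1 - complex.Re (`|x| ^+ 2))%:E * functional_norm ('d f x))%E
            | x in unit_ball E].

(* f belongs to the Bloch space: analytic (C-Frechet differentiable) on B_E
   with finite Bloch seminorm *)
Definition in_bloch (E : completeNormedModType C) (f : E -> C^o) : Prop :=
  (forall x, x \in unit_ball E -> differentiable f x) /\
  (bloch_seminorm f < +oo)%E.

Definition bloch_norm (E : completeNormedModType C) (f : E -> C^o) : \bar R :=
  ((complex.Re `|f 0|)%:E + bloch_seminorm f)%E.

Definition compact_composition_operator (E : completeNormedModType C)
    (phi : E -> E) : Prop :=
  (forall f : E -> C^o, in_bloch f -> in_bloch (f \o phi)) /\
  (forall (u : nat -> E -> C^o) (M : R),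
     (forall n, in_bloch (u n) /\ (bloch_norm (u n) <= M%:E)%E) ->
     exists (s : nat -> nat) (g : E -> C^o),
       (forall n, (s n < s n.+1)%N) /\ in_bloch g /\
       (forall eps : R, 0 < eps -> exists N : nat, forall n, (N <= n)%N ->
          (bloch_norm (((u (s n)) \o phi) - g)%R < eps%:E)%E)).

End Hilbert.
Arguments unit_ball {R} E.

(* Main.v *)
Require Import Defs.
From HB Require Import structures.
From mathcomp Require Import all_boot all_order all_algebra.
From mathcomp Require Import complex finmap.
From mathcomp Require Import all_classical all_reals all_analysis.
From mathcomp Require Import ring lra.
Import numFieldNormedType.Exports.
Import Order.TTheory GRing.Theory Num.Theory.
Local Open Scope ring_scope.
Local Open Scope classical_set_scope.

(** The radial derivative alone controls the Bloch seminorm.  If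
    [(1 - |z|^2) |f'(z) z| <= S] on the ball then, for [s < 1], the difference
    [x |-> f x - f (s x)] is bounded near [z], so that Cauchy's estimate compares
    [f'(z)] with [s f'(s z)]; choosing [1 - |s z| = 2 (1 - |z|)] and iterating, the
    errors form a geometric series.  On vectors orthogonal to [z] the same
    comparison can be made on discs of radius [sqrt (1 - |z|)], which improves
    the bound to [|f'(z) v| <= C S |v| / sqrt (1 - |z|)].  By (ii) and (iii),
    [(1 - |z|^2) |f'(phi z) (R phi z)|] is thus uniformly small over bounded
    families of Bloch functions when [|phi z|] is close to 1.

    [E] need not be separable, so Montel's theorem is replaced by limits along a
    free ultrafilter [U] on [nat]: [u n \o phi] has a pointwise limit [g], which is
    holomorphic because second-order Taylor bounds are uniform in [n].  On
    [|phi z| <= delta] the derivatives are uniformly Lipschitz, so by (i) their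
    convergence has to be tested at finitely many points only.  Hence
    [u n \o phi] is close to [g] in norm for [U]-many [n], and a subsequence
    converges.

    Cauchy's estimate itself is proved without integrals, by Goursat's bisection
    argument applied to trapezoid sums. *)

Set Implicit Arguments.
Unset Strict Implicit.
Unset Printing Implicit Defensive.

(** * Real-valued norms *)

Section RealNorm.
Variable R : realType.
Local Notation C := (R[i])%C.
Implicit Type V : normedZmodType C.

(** The library norm takes values in [C], where the order is partial. Its real part carries the same
    information and lets real arithmetic be used throughout. *)
Definition nrm {V} (x : V) : R := complex.Re `|x|.

Lemma nrmE V (x : V) : `|x| = (nrm x)%:C%C.
Proof.
have := normr_ge0 x; rewrite /nrm lecE /= => /andP[/eqP + _].
by case: `|x| => a b /= ->.
Qed.

Lemma nrm_ge0 V (x : V) : 0 <= nrm x.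
Proof. rewrite -lecR -nrmE; exact: normr_ge0. Qed.

Lemma nrm0 V : nrm (0 : V) = 0.
Proof. by rewrite /nrm normr0. Qed.

Lemma nrmD V (x y : V) : nrm (x + y) <= nrm x + nrm y.
Proof. by rewrite -lecR rmorphD /= -!nrmE ler_normD. Qed.

Lemma nrmN V (x : V) : nrm (- x) = nrm x.
Proof. by rewrite /nrm normrN. Qed.

Lemma nrmC V (x y : V) : nrm (x - y) = nrm (y - x).
Proof. by rewrite /nrm distrC. Qed.

Lemma nrmB V (x y : V) : nrm (x - y) <= nrm x + nrm y.
Proof. by rewrite -(nrmN y) nrmD. Qed.

Lemma nrm_gt0 V (x : V) : (0 < nrm x) = (x != 0).
Proof. by rewrite -ltcR -nrmE normr_gt0. Qed.

Lemma nrm_eq0 V (x : V) : nrm x = 0 -> x = 0.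
Proof. by move=> h; apply/eqP; rewrite -normr_eq0 nrmE h. Qed.

Lemma nrmM (a b : C) : nrm (a * b) = nrm a * nrm b.
Proof. by apply: complexI; rewrite rmorphM /= -!nrmE normrM. Qed.

Lemma nrmV (a : C) : nrm a^-1 = (nrm a)^-1.
Proof. by apply: complexI; rewrite fmorphV /= -!nrmE normfV. Qed.

Lemma nrmZ (V : normedModType C) (a : C) (x : V) : nrm (a *: x) = nrm a * nrm x.
Proof. by apply: complexI; rewrite rmorphM /= -!nrmE normrZ. Qed.

Lemma nrmR (t : R) : nrm (t%:C%C : C) = `|t|.
Proof. by rewrite /nrm normc_def /= expr0n addr0 sqrtr_sqr. Qed.

Lemma nrmP (t : R) : 0 <= t -> nrm (t%:C%C : C) = t.
Proof. by move=> t0; rewrite nrmR ger0_norm. Qed.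

Lemma nrm1 : nrm (1 : C) = 1.
Proof. by rewrite /nrm normr1. Qed.

Lemma nrm_sqr (a : C) : nrm a ^+ 2 = complex.Re a ^+ 2 + complex.Im a ^+ 2.
Proof. by rewrite /nrm normc_def /= sqr_sqrtr // addr_ge0 ?sqr_ge0. Qed.

Lemma Re_le_nrm (a : C) : `|complex.Re a| <= nrm a.
Proof.
rewrite -(ler_pXn2r (n:=2)) ?nnegrE ?nrm_ge0 //.
by rewrite nrm_sqr real_normK ?num_real // lerDl sqr_ge0.
Qed.

Lemma Im_le_nrm (a : C) : `|complex.Im a| <= nrm a.
Proof.
rewrite -(ler_pXn2r (n:=2)) ?nnegrE ?nrm_ge0 //.
by rewrite nrm_sqr real_normK ?num_real // lerDr sqr_ge0.
Qed.

Lemma nrm_le_ReIm (a : C) : nrm a <= `|complex.Re a| + `|complex.Im a|.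
Proof.
rewrite -(ler_pXn2r (n:=2)) ?nnegrE ?nrm_ge0 ?addr_ge0 //.
rewrite nrm_sqr sqrrD !real_normK ?num_real //.
by rewrite lerD2r lerDl mulrn_wge0 // mulr_ge0.
Qed.

Lemma nrm_i : nrm ('i%C : C) = 1.
Proof. by rewrite /nrm normc_def /= expr0n add0r expr1n sqrtr1. Qed.

Lemma nrm_triB V (x y z : V) : nrm (x - z) <= nrm (x - y) + nrm (y - z).
Proof. by apply: le_trans (nrmD _ _); rewrite addrA subrK. Qed.

Lemma nrm_leB V (x y : V) : nrm x <= nrm y + nrm (x - y).
Proof. by apply: le_trans (nrmD _ _); rewrite addrC subrK. Qed.

Lemma dyadic_small (c e : R) : 0 < e -> exists n : nat, c / 2 ^+ n < e.
Proof.
move=> e0; have := archi_boundP (normr_ge0 (c / e)).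
set n := Num.bound _ => hn; exists n.
rewrite ltr_pdivrMr ?exprn_gt0 // mulrC -ltr_pdivrMr //.
apply: le_lt_trans (ler_norm _) (lt_le_trans hn _).
by rewrite -natrX ler_nat ltnW // ltn_expl.
Qed.

Lemma nested_intervals (s t : nat -> R) :
  (forall n, s n <= s n.+1 /\ t n.+1 <= t n) -> (forall n, s n <= t n) ->
  exists l, forall n, s n <= l <= t n.
Proof.
move=> mono st.
have smono n m : s n <= s (n + m)%N.
  by elim: m => [|m IH]; rewrite ?addn0 // addnS (le_trans IH) // (mono _).1.
have tmono n m : t (n + m)%N <= t n.
  by elim: m => [|m IH]; rewrite ?addn0 // addnS (le_trans _ IH) // (mono _).2.
have le_st n m : s n <= t m.
  apply: le_trans (smono n m) _; rewrite addnC; apply: le_trans (st _) _.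
  exact: tmono.
have ub : has_ubound (range s) by exists (t 0%N) => _ [n _ <-].
exists (sup (range s)) => n; apply/andP; split.
  by apply: ub_le_sup => //; exists n.
apply: ge_sup; first by exists (s 0%N), 0%N.
by move=> _ [m _ <-].
Qed.

End RealNorm.

(** * Goursat's lemma for trapezoid sums *)

Section Goursat.
Variable R : realType.
Local Notation C := (R[i])%C.
Implicit Types (g : C -> C) (a b c z w : C).

(** The intervals of radius [2 * c / 2 ^+ k] about [u k] are nested: from [k] to [k.+1] the radius
    drops by [c / 2 ^+ k], which is as far as the centre can move. *)
Lemma dyadic_cauchy (u : nat -> R) (c : R) :
  (forall k, `|u k.+1 - u k| <= c / 2 ^+ k) ->
  exists l, forall k, `|u k - l| <= 2 * c / 2 ^+ k.
Proof.
move=> hu.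
have [k|k|l hl] := @nested_intervals R (fun k => u k - 2 * c / 2 ^+ k)
    (fun k => u k + 2 * c / 2 ^+ k).
- have := hu k; rewrite ler_norml exprS invfM => /andP[h1 h2].
  move: h1 h2; set p := (2 ^+ k)^-1 => h1 h2; split; lra.
- have := hu k; rewrite ler_norml => /andP[]; lra.
exists l => k; have := hl k; rewrite ler_norml => /andP[]; lra.
Qed.

Lemma dyadic_cauchyC (u : nat -> C) (c : R) :
  (forall k, nrm (u k.+1 - u k) <= c / 2 ^+ k) ->
  exists l, forall k, nrm (u k - l) <= 4 * c / 2 ^+ k.
Proof.
move=> hu.
have [k|l1 h1] := @dyadic_cauchy (fun k => complex.Re (u k)) c.
  by apply: le_trans (hu k); rewrite -raddfB Re_le_nrm.
have [k|l2 h2] := @dyadic_cauchy (fun k => complex.Im (u k)) c.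
  by apply: le_trans (hu k); rewrite -raddfB Im_le_nrm.
exists (l1 +i* l2)%C => k; apply: le_trans (nrm_le_ReIm _) _.
have := h1 k; have := h2 k; rewrite !raddfB /=; lra.
Qed.

(** Pointwise complex derivative without quotients and with real radii, so that the calculus rules
    below reduce to elementary inequalities. *)
Definition cderiv g z d := forall e : R, 0 < e ->
  exists2 del : R, 0 < del &
  forall w, nrm (w - z) < del -> nrm (g w - g z - d * (w - z)) <= e * nrm (w - z).

(* Trapezoid sum of [g dz] over the segment [a, b] cut into [2 ^ n] equal parts. *)
Fixpoint trap g (n : nat) a b : C :=
  if n is n'.+1 then trap g n' a ((a + b) / 2) + trap g n' ((a + b) / 2) b
  else (g a + g b) / 2 * (b - a).

Definition tri g n a b c := trap g n a b + trap g n b c + trap g n c a.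

Lemma trap_anti g n a b : trap g n b a = - trap g n a b.
Proof.
elim: n a b => [|n IH] a b /=; first by ring.
by rewrite (addrC b) (IH a) (IH _ b); ring.
Qed.

(** Each of the three inner edges is traversed twice, in opposite directions, and cancels by
    [trap_anti]. The identity is exact at every level of subdivision. *)
Lemma triS g n a b c : tri g n.+1 a b c =
  tri g n a ((a + b) / 2) ((a + c) / 2) + tri g n ((a + b) / 2) b ((b + c) / 2) +
  tri g n ((a + c) / 2) ((b + c) / 2) c +
  tri g n ((a + b) / 2) ((b + c) / 2) ((a + c) / 2).
Proof.
rewrite /tri /= (addrC c a).
rewrite (trap_anti g n ((a + b) / 2) ((a + c) / 2)).
rewrite (trap_anti g n ((a + b) / 2) ((b + c) / 2)).
rewrite (trap_anti g n ((a + c) / 2) ((b + c) / 2)).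
ring.
Qed.

Lemma trapD g1 g2 n a b :
  trap (fun z => g1 z + g2 z) n a b = trap g1 n a b + trap g2 n a b.
Proof. by elim: n a b => [|n IH] a b /=; [ring|rewrite !IH; ring]. Qed.

Lemma trapZ (k : C) g n a b : trap (fun z => k * g z) n a b = k * trap g n a b.
Proof. by elim: n a b => [|n IH] a b /=; [ring|rewrite !IH; ring]. Qed.

Lemma eq_trap g1 g2 n a b : g1 =1 g2 -> trap g1 n a b = trap g2 n a b.
Proof. by move=> e; elim: n a b => [|n IH] a b /=; rewrite ?e ?IH. Qed.

Lemma trap_rot g n a b k : (forall z, g (k * z) * k = g z) ->
  trap g n (k * a) (k * b) = trap g n a b.
Proof.
move=> e; elim: n a b => [|n IH] a b /=.
  by rewrite -(e a) -(e b); ring.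
by rewrite -mulrDr -mulrA !IH.
Qed.

(** The trapezoid rule is exact on affine functions, whatever [n] is; hence affine parts disappear
    from sums around a triangle. *)
Lemma trap_affine (p q z0 : C) n a b : trap (fun z => p + q * (z - z0)) n a b =
  (p + q * ((a + b) / 2 - z0)) * (b - a).
Proof.
by elim: n a b => [|n IH] a b /=; rewrite ?IH; field.
Qed.

Lemma nrm_half (x : C) : nrm (x / 2) = nrm x / 2.
Proof. by rewrite nrmM nrmV; congr (_ / _); rewrite -[2](rmorph_nat (real_complex R) 2) nrmP. Qed.

(** The only consequence of convexity that bisection uses. *)
Definition midpoint_closed (K : set C) :=
  forall x y, K x -> K y -> K ((x + y) / 2).

Lemma trap_bound (K : set C) g (m : R) n a b : midpoint_closed K ->
  (forall z, K z -> nrm (g z) <= m) -> K a -> K b ->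
  nrm (trap g n a b) <= m * nrm (b - a).
Proof.
move=> mK gm; elim: n a b => [|n IH] a b Ka Kb /=.
  rewrite nrmM ler_wpM2r ?nrm_ge0 // nrm_half.
  by have := nrmD (g a) (g b); have := gm _ Ka; have := gm _ Kb; lra.
have Km := mK _ _ Ka Kb.
apply: le_trans (nrmD _ _) _; apply: le_trans (lerD (IH _ _ Ka Km) (IH _ _ Km Kb)) _.
have -> : (a + b) / 2 - a = (b - a) / 2 by field.
have -> : b - (a + b) / 2 = (b - a) / 2 by field.
by rewrite nrm_half; lra.
Qed.

(** The rectangle may be degenerate: with [x0 = x1] it is a vertical segment, such as a side of a
    square. *)
Definition rect (x0 x1 y0 y1 : R) : set C :=
  [set z | x0 <= complex.Re z <= x1 /\ y0 <= complex.Im z <= y1].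

Lemma Re_half (x : C) : complex.Re (x / 2) = complex.Re x / 2.
Proof.
have -> : x / 2 = x * (2^-1)%:C%C by rewrite fmorphV rmorph_nat.
by case: x => p q /=; rewrite mulr0 subr0.
Qed.

Lemma Im_half (x : C) : complex.Im (x / 2) = complex.Im x / 2.
Proof.
have -> : x / 2 = x * (2^-1)%:C%C by rewrite fmorphV rmorph_nat.
by case: x => p q /=; rewrite mulr0 add0r.
Qed.

Lemma rect_midpoint x0 x1 y0 y1 : midpoint_closed (rect x0 x1 y0 y1).
Proof.
move=> x y [/andP[? ?] /andP[? ?]] [/andP[? ?] /andP[? ?]].
by rewrite /rect /= Re_half Im_half !raddfD /=; split; lra.
Qed.

Lemma le_dyadic (x y c : R) : (forall k : nat, x <= y + c / 2 ^+ k) -> x <= y.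
Proof.
move=> h; rewrite leNgt; apply/negP => yx.
have [|k hk] := @dyadic_small R c (x - y); first lra.
by have := h k; lra.
Qed.

Lemma rect_closed x0 x1 y0 y1 (u : nat -> C) (l : C) (c : R) :
  (forall k, rect x0 x1 y0 y1 (u k)) -> (forall k, nrm (u k - l) <= c / 2 ^+ k) ->
  rect x0 x1 y0 y1 l.
Proof.
move=> hu hl.
have hre k : `|complex.Re (u k) - complex.Re l| <= c / 2 ^+ k.
  by apply: le_trans (hl k); rewrite -raddfB Re_le_nrm.
have him k : `|complex.Im (u k) - complex.Im l| <= c / 2 ^+ k.
  by apply: le_trans (hl k); rewrite -raddfB Im_le_nrm.
split; apply/andP; split; apply: (@le_dyadic _ _ c) => k;
  have := hre k; have := him k; rewrite !ler_norml => /andP[? ?] /andP[? ?];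
  by have [/andP[? ?] /andP[? ?]] := hu k; lra.
Qed.

(** Replaces a bound on the contour integral around the triangle: the sums are only asked to be
    small for all fine subdivisions. *)
Definition tri_vanish g (e : R) a b c :=
  exists N : nat, forall n, (N <= n)%N -> nrm (tri g n a b c) <= e.

Lemma tri_vanish4 g e a b c :
  tri_vanish g (e / 4) a ((a + b) / 2) ((a + c) / 2) ->
  tri_vanish g (e / 4) ((a + b) / 2) b ((b + c) / 2) ->
  tri_vanish g (e / 4) ((a + c) / 2) ((b + c) / 2) c ->
  tri_vanish g (e / 4) ((a + b) / 2) ((b + c) / 2) ((a + c) / 2) ->
  tri_vanish g e a b c.
Proof.
move=> [N1 h1] [N2 h2] [N3 h3] [N4 h4].
exists (maxn (maxn N1 N2) (maxn N3 N4)).+1 => -[//|n]; rewrite ltnS !geq_max.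
move=> /andP[/andP[/h1 k1 /h2 k2] /andP[/h3 k3 /h4 k4]]; rewrite triS.
do 3 (apply: le_trans (nrmD _ _) _; rewrite -lerBrDr).
by lra.
Qed.

Definition tri_in (K : set C) (D : R) a b c :=
  [/\ K a, K b & K c] /\ [/\ nrm (b - a) <= D, nrm (c - b) <= D & nrm (a - c) <= D].

Lemma tri_inP (K : set C) D a b c : midpoint_closed K -> tri_in K D a b c ->
  [/\ tri_in K (D / 2) a ((a + b) / 2) ((a + c) / 2),
      tri_in K (D / 2) ((a + b) / 2) b ((b + c) / 2),
      tri_in K (D / 2) ((a + c) / 2) ((b + c) / 2) c &
      tri_in K (D / 2) ((a + b) / 2) ((b + c) / 2) ((a + c) / 2)].
Proof.
move=> mK [[Ka Kb Kc] [h1 h2 h3]].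
have e1 : nrm ((b - a) / 2) <= D / 2 by rewrite nrm_half; lra.
have e2 : nrm ((c - b) / 2) <= D / 2 by rewrite nrm_half; lra.
have e3 : nrm ((a - c) / 2) <= D / 2 by rewrite nrm_half; lra.
have f1 : nrm ((a - b) / 2) <= D / 2 by rewrite -nrmN -mulNr opprB.
have f2 : nrm ((b - c) / 2) <= D / 2 by rewrite -nrmN -mulNr opprB.
have f3 : nrm ((c - a) / 2) <= D / 2 by rewrite -nrmN -mulNr opprB.
have close x y : nrm x <= D / 2 -> x = y -> nrm y <= D / 2 by move=> + <-.
split; split; split; first [ by [] | by apply: mK |
  by apply: close e1 _; field | by apply: close e2 _; field
| by apply: close e3 _; field | by apply: close f1 _; field
| by apply: close f2 _; field | by apply: close f3 _; field ].
Qed.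

(** If the sums do not become smaller than [e], then on one of the four half-size triangles they do
    not become smaller than [e / 4]. Iterating, the triangles shrink to a point, where
    differentiability gives a remainder too small for this. *)
Lemma goursat g x0 x1 y0 y1 a b c (e : R) :
  (forall z, rect x0 x1 y0 y1 z -> exists d, cderiv g z d) ->
  rect x0 x1 y0 y1 a -> rect x0 x1 y0 y1 b -> rect x0 x1 y0 y1 c -> 0 < e ->
  tri_vanish g e a b c.
Proof.
set K := rect _ _ _ _ => dg Ka Kb Kc e0; apply: contrapT => bad.
have mK : midpoint_closed K by exact: rect_midpoint.
(* The summand 1 keeps [D] positive when the triangle is a single point. *)
pose D := nrm (b - a) + nrm (c - b) + nrm (a - c) + 1.
have D0 : 0 < D by rewrite ltr_pwDr // !addr_ge0 // nrm_ge0.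
pose P k (t : C * C * C) :=
  tri_in K (D / 2 ^+ k) t.1.1 t.1.2 t.2 /\
  ~ tri_vanish g (e / 4 ^+ k) t.1.1 t.1.2 t.2.
have P0 : P 0%N (a, b, c).
  split=> /=; rewrite ?expr0 ?divr1 //; split=> //.
  have := nrm_ge0 (b - a); have := nrm_ge0 (c - b); have := nrm_ge0 (a - c).
  by rewrite /D; split; lra.
(* [P k t] is placed under the existential so that [choice] gives a total successor function. *)
have step k t : exists t', P k t -> P k.+1 t' /\ nrm (t'.1.1 - t.1.1) <= D / 2 ^+ k.
  have [[tin nv]|nP] := pselect (P k t); last by exists t.
  have [i1 i2 i3 i4] := tri_inP mK tin.
  have E2 : D / 2 ^+ k / 2 = D / 2 ^+ k.+1 by rewrite exprSr invfM mulrA.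
  have E4 : e / 4 ^+ k / 4 = e / 4 ^+ k.+1 by rewrite exprSr invfM mulrA.
  have D2 : D / 2 ^+ k / 2 <= D / 2 ^+ k.
    by rewrite ler_pdivrMr // ler_peMr ?divr_ge0 ?exprn_ge0 ?ltW //; lra.
  rewrite E2 in i1 i2 i3 i4 D2.
  apply: contrapT => no; apply: nv.
  apply: tri_vanish4; rewrite E4; apply: contrapT => nv; apply: no.
  - exists (t.1.1, (t.1.1 + t.1.2) / 2, (t.1.1 + t.2) / 2); split; first by split.
    by rewrite subrr nrm0; apply: divr_ge0; rewrite ?exprn_ge0 // ltW.
  - exists ((t.1.1 + t.1.2) / 2, t.1.2, (t.1.2 + t.2) / 2); split; first by split.
    by have [_ [h _ _]] := i1; apply: le_trans h D2.
  - exists ((t.1.1 + t.2) / 2, (t.1.2 + t.2) / 2, t.2); split; first by split.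
    by have [_ [_ _ h]] := i1; rewrite nrmC; apply: le_trans h D2.
  exists ((t.1.1 + t.1.2) / 2, (t.1.2 + t.2) / 2, (t.1.1 + t.2) / 2); split; first by split.
  by have [_ [h _ _]] := i1; apply: le_trans h D2.
have [f hf] := choice (fun kt : nat * (C * C * C) => step kt.1 kt.2).
pose t := fix t k := if k is k'.+1 then f (k', t k') else (a, b, c).
have Pt k : P k (t k) by elim: k => [//|k IH] /=; have [] := hf (k, t k) IH.
have [k|l hl] := @dyadic_cauchyC (fun k => (t k).1.1) D.
  by have [] := hf (k, t k) (Pt k).
have Kl : K l.
  apply: (@rect_closed _ _ _ _ (fun k => (t k).1.1) l (4 * D)) => // k.
  by have [[[]]] := Pt k.
have [d hd] := dg _ Kl.
(* The vertices lie within [5 * q] of [l], where [q = D / 2 ^+ k], and each side has length at most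
   [q]. The remainder thus contributes at most [15 * eta * q ^+ 2], half of [e / 4 ^+ k]. *)
pose eta := e / (30 * D ^+ 2).
have eta0 : 0 < eta by rewrite divr_gt0 // mulr_gt0 // exprn_gt0.
have [del del0 hdel] := hd _ eta0.
have [k hk] := dyadic_small (5 * D) del0.
have [[[K1 K2 K3] [s1 s2 s3]] nv] := Pt k.
apply: nv; exists 0%N => n _.
move: (hl k) K1 K2 K3 s1 s2 s3; case: (t k) => [[x y] z] /=.
set q := D / 2 ^+ k => hx Kx Ky Kz s1 s2 s3.
have q0 : 0 < q by rewrite divr_gt0 // exprn_gt0.
have hx4 : nrm (x - l) <= 4 * q by rewrite /q mulrA.
have hy : nrm (y - l) <= 5 * q by have := nrm_triB y x l; lra.
have hz : nrm (z - l) <= 5 * q by have := nrm_triB z x l; rewrite (nrmC z x); lra.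
(* Subtracting the affine approximation at [l] leaves the sum around the closed triangle
   unchanged. *)
pose r w := g w + - (g l + d * (w - l)).
have -> : tri g n x y z = tri r n x y z.
  rewrite /tri.
  have E u v : trap r n u v = trap g n u v - (g l + d * ((u + v) / 2 - l)) * (v - u).
    rewrite trapD -(trap_affine _ _ _ n); congr (_ + _).
    by rewrite -[RHS]mulN1r -trapZ; apply: eq_trap => w; rewrite mulN1r.
  by rewrite !E; field.
pose L := [set w : C | nrm (w - l) <= 5 * q].
have mL : midpoint_closed L.
  move=> u v; rewrite /L /= => hu hv.
  have -> : (u + v) / 2 - l = (u - l) / 2 + (v - l) / 2 by field.
  by apply: le_trans (nrmD _ _) _; rewrite !nrm_half; lra.
have bnd w : L w -> nrm (r w) <= eta * (5 * q).
  move=> hw; have := hdel w; rewrite /r opprD addrA => h.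
  apply: le_trans (h _) _; last by rewrite ler_pM2l.
  by apply: le_lt_trans hw _; apply: le_lt_trans hk; rewrite /q mulrA.
have Lx : L x by rewrite /L /=; lra.
have tb u v : L u -> L v -> nrm (v - u) <= q -> nrm (trap r n u v) <= eta * (5 * q) * q.
  move=> Lu Lv uv; apply: le_trans (trap_bound n mL bnd Lu Lv) _.
  by rewrite ler_wpM2l //; have := mulr_gt0 eta0 q0; lra.
have t1 := tb _ _ Lx hy s1; have t2 := tb _ _ hy hz s2; have t3 := tb _ _ hz Lx s3.
have E : e / 4 ^+ k = 30 * eta * q ^+ 2.
  rewrite /eta /q (_ : 4 = 2 * 2 :> R); last lra.
  rewrite exprMn; field; rewrite expf_neq0 //; lra.
rewrite E /tri; apply: le_trans (nrmD _ _) _.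
have := nrmD (trap r n x y) (trap r n y z).
have : 0 < eta * q ^+ 2 by rewrite mulr_gt0 // exprn_gt0.
nra.
Qed.
End Goursat.

(** * Cauchy's estimate *)

Section Cauchy.
Variable R : realType.
Local Notation C := (R[i])%C.
Implicit Types (g h : C -> C) (a b c z w d : C).

Lemma cderivD g h z d1 d2 : cderiv g z d1 -> cderiv h z d2 ->
  cderiv (fun w => g w + h w) z (d1 + d2).
Proof.
move=> dg dh e e0; have e2 : 0 < e / 2 by lra.
have [s s0 hs] := dg _ e2; have [t t0 ht] := dh _ e2.
exists (Num.min s t); rewrite ?lt_min ?s0 // => w; rewrite lt_min => /andP[ws wt].
have -> : g w + h w - (g z + h z) - (d1 + d2) * (w - z) =
  (g w - g z - d1 * (w - z)) + (h w - h z - d2 * (w - z)) by ring.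
by apply: le_trans (nrmD _ _) _; have := hs w ws; have := ht w wt; lra.
Qed.

Lemma cderiv_lip g z d : cderiv g z d -> exists2 s : R, 0 < s &
  forall w, nrm (w - z) < s -> nrm (g w - g z) <= (nrm d + 1) * nrm (w - z).
Proof.
move=> /(_ 1 ltr01)[s s0 hs]; exists s => // w /hs h.
have -> : g w - g z = (g w - g z - d * (w - z)) + d * (w - z) by ring.
apply: le_trans (nrmD _ _) _; rewrite nrmM; lra.
Qed.

Lemma cderivM g h z d1 d2 : cderiv g z d1 -> cderiv h z d2 ->
  cderiv (fun w => g w * h w) z (d1 * h z + g z * d2).
Proof.
move=> dg dh e e0.
have [s1 s10 lh] := cderiv_lip dh.
set k := nrm d2 + 1 in lh; have k0 : 0 < k by rewrite ltr_pwDr // nrm_ge0.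
(* [A] dominates every factor that occurs, and [e'] is chosen so that each of the three terms of the
   remainder is at most [e / 3] times [nrm (w - z)]. *)
pose A := nrm (h z) + nrm (g z) + k + nrm d1 + 1.
have A0 : 0 < A by rewrite /A; have := nrm_ge0 (h z); have := nrm_ge0 (g z);
  have := nrm_ge0 d1; lra.
pose e' := e / (3 * A ^+ 2); have e'0 : 0 < e' by rewrite divr_gt0 // mulr_gt0 // exprn_gt0.
have [s2 s20 hg] := dg _ e'0; have [s3 s30 hh] := dh _ e'0.
exists (Num.min (Num.min s1 s2) (Num.min s3 (Num.min e' 1))).
  by rewrite !lt_min s10 s20 s30 e'0 ltr01.
move=> w; rewrite !lt_min => /andP[/andP[/lh w1 /hg w2]] /andP[/hh w3] /andP[w4 w5].
have -> : g w * h w - g z * h z - (d1 * h z + g z * d2) * (w - z) =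
  (g w - g z - d1 * (w - z)) * (h z + (h w - h z)) + d1 * (w - z) * (h w - h z) +
  g z * (h w - h z - d2 * (w - z)) by ring.
move: w1 w2 w3 w4 w5; set t := nrm (w - z) => w1 w2 w3 w4 w5.
have t0 : 0 <= t by exact: nrm_ge0.
have P1 : nrm (h z + (h w - h z)) <= A.
  apply: le_trans (nrmD _ _) _; have := nrm_ge0 (g z); have := nrm_ge0 d1.
  have : k * t <= k by rewrite ler_piMr // ltW.
  rewrite /A; lra.
have A1 : 1 <= A.
  by rewrite /A; have := nrm_ge0 (h z); have := nrm_ge0 (g z); have := nrm_ge0 d1; lra.
have Ee : e = 3 * (e' * A ^+ 2) by rewrite /e'; field; lra.
apply: le_trans (nrmD _ _) _; rewrite [X in _ + X]nrmM.
apply: le_trans (lerD (nrmD _ _) (lexx _)) _; rewrite !nrmM -/t.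
have Q1 : nrm (g w - g z - d1 * (w - z)) * nrm (h z + (h w - h z)) <= e' * t * A.
  by apply: ler_pM => //; exact: nrm_ge0.
have Q2 : nrm d1 * t * nrm (h w - h z) <= A * (e' * t * A).
  have k1 : nrm (h w - h z) <= A * e'.
    apply: le_trans w1 _; apply: ler_pM; rewrite ?(ltW k0) //; last exact: ltW.
    by rewrite /A; have := nrm_ge0 (h z); have := nrm_ge0 (g z); have := nrm_ge0 d1; lra.
  have d1A : nrm d1 <= A by rewrite /A; have := nrm_ge0 (h z); have := nrm_ge0 (g z); lra.
  have := ler_pM (mulr_ge0 (nrm_ge0 d1) t0) (nrm_ge0 _) (ler_wpM2r t0 d1A) k1; lra.
have Q3 : nrm (g z) * nrm (h w - h z - d2 * (w - z)) <= A * (e' * t).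
  apply: ler_pM => //; rewrite ?nrm_ge0 // /A; have := nrm_ge0 (h z); have := nrm_ge0 d1; lra.
have p0 : 0 <= e' * t * A * (A - 1).
  apply: mulr_ge0; last by rewrite subr_ge0.
  by apply: mulr_ge0 (ltW A0); apply: mulr_ge0 (ltW e'0) _.
rewrite Ee; lra.
Qed.

Lemma cderiv_ext g h z d : (forall w, g w = h w) -> cderiv g z d -> cderiv h z d.
Proof. by move=> /funext ->. Qed.

Lemma cderivV z : z != 0 -> cderiv (fun w => w^-1) z (- z^-1 ^+ 2).
Proof.
move=> z0 e e0; have nz : 0 < nrm z by rewrite nrm_gt0.
set m := nrm z in nz.
exists (Num.min (m / 2) (e * m ^+ 3 / 2)).
  by rewrite lt_min !divr_gt0 // mulr_gt0 // exprn_gt0.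
move=> w; rewrite lt_min => /andP[w1 w2].
have nw : m / 2 <= nrm w by have := nrm_leB z w; rewrite (nrmC z) -/m; lra.
have w0 : w != 0 by rewrite -nrm_gt0; lra.
have -> : w^-1 - z^-1 - - z^-1 ^+ 2 * (w - z) = (w - z) ^+ 2 / (z ^+ 2 * w).
  by field; apply/andP.
rewrite nrmM nrmV !nrmM -/m ler_pdivrMr; last by rewrite !mulr_gt0 //; lra.
have t0 := nrm_ge0 (w - z).
rewrite -mulrA [e * _]mulrC -mulrA; apply: ler_wpM2l => //.
have : 0 < m ^+ 2 * e by rewrite mulr_gt0 // exprn_gt0.
nra.
Qed.

Lemma cderiv_scale g k z d : k != 0 -> cderiv g (k * z) d -> cderiv (fun w => g (k * w)) z (d * k).
Proof.
move=> k0 dg e e0; have nk : 0 < nrm k by rewrite nrm_gt0.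
have [|s s0 hs] := dg (e / nrm k); first by rewrite divr_gt0.
exists (s / nrm k); first by rewrite divr_gt0.
move=> w hw; have := hs (k * w); rewrite -mulrBr nrmM mulrC -ltr_pdivlMr // => /(_ hw).
by rewrite mulrA [X in _ <= X](_ : _ = e * nrm (w - z)) //; field; lra.
Qed.

Lemma cderiv_cst k z : cderiv (fun _ => k) z 0.
Proof.
move=> e e0; exists 1 => // w _.
by rewrite subrr mul0r subr0 nrm0 mulr_ge0 ?nrm_ge0 // ltW.
Qed.

Lemma cderivZ g k z d : cderiv g z d -> cderiv (fun w => k * g w) z (k * d).
Proof.
by move=> dg; have := cderivM (cderiv_cst k z) dg; rewrite mul0r add0r.
Qed.

Lemma Re_inv (a : C) : complex.Re a^-1 = complex.Re a / (complex.Re a ^+ 2 + complex.Im a ^+ 2).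
Proof. by case: a. Qed.

Lemma Im_mul (a b : C) :
  complex.Im (a * b) = complex.Re a * complex.Im b + complex.Im a * complex.Re b.
Proof. by case: a => x y; case: b. Qed.

(** On the line [Re z = eta] the imaginary part of [dz / z] is [eta / (eta ^+ 2 + y ^+ 2) dy], at
    least [dy / (2 * eta)] for [|y| <= eta]. Over a whole side this yields 1, a crude substitute for
    the exact integral [pi / 2]. *)
Lemma Im_trap_inv (eta : R) n a b : 0 < eta -> complex.Re a = eta -> complex.Re b = eta ->
  - eta <= complex.Im a -> complex.Im a <= complex.Im b -> complex.Im b <= eta ->
  (complex.Im b - complex.Im a) / (2 * eta) <= complex.Im (trap (fun z => z^-1) n a b).
Proof.
move=> eta0; elim: n a b => [|n IH] a b ha hb a1 ab b1 /=.
  have inv (y : R) : - eta <= y <= eta -> (2 * eta)^-1 <= eta / (eta ^+ 2 + y ^+ 2).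
    move=> /andP[y1 y2].
    rewrite ler_pdivlMr; last by rewrite ltr_pwDl ?exprn_gt0 ?sqr_ge0.
    rewrite mulrC ler_pdivrMr ?mulr_gt0 //.
    have : 0 <= (eta - y) * (eta + y) by apply: mulr_ge0; lra.
    lra.
  have := inv (complex.Im a); have := inv (complex.Im b) => i2 i1.
  have {}i1 := i1 ltac:(lra); have {}i2 := i2 ltac:(lra).
  rewrite Im_mul [complex.Re (b - a)]raddfB /= ha hb subrr mulr0 addr0 Re_half.
  rewrite raddfD /= !Re_inv ha hb raddfB /=.
  rewrite mulrC; apply: ler_wpM2r; lra.
have hm : complex.Re ((a + b) / 2) = eta by rewrite Re_half raddfD /=; lra.
have im : complex.Im ((a + b) / 2) = (complex.Im a + complex.Im b) / 2.
  by rewrite Im_half raddfD.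
rewrite raddfD /=.
have := IH a ((a + b) / 2) ha hm a1; have := IH ((a + b) / 2) b hm hb; rewrite im.
move=> k1 k2; have := k1 ltac:(lra) ltac:(lra) b1; have := k2 ltac:(lra) ltac:(lra).
set u := (2 * eta)^-1; lra.
Qed.

Lemma rotD_bound g (r M : R) z : (forall z, nrm z < r -> nrm (g z) <= M) -> nrm z < r ->
  nrm (g z - 'i%C * g ('i%C * z) - g (- z) + 'i%C * g (- ('i%C * z))) <= 4 * M.
Proof.
move=> gM hz.
have h1 := gM _ hz.
have h2 : nrm (g ('i%C * z)) <= M by apply: gM; rewrite nrmM nrm_i mul1r.
have h3 : nrm (g (- z)) <= M by apply: gM; rewrite nrmN.
have h4 : nrm (g (- ('i%C * z))) <= M by apply: gM; rewrite nrmN nrmM nrm_i mul1r.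
apply: le_trans (nrmD _ _) _; rewrite nrmM nrm_i mul1r.
have k1 := nrmB (g z - 'i%C * g ('i%C * z)) (g (- z)).
have := nrmB (g z) ('i%C * g ('i%C * z)); rewrite nrmM nrm_i mul1r; lra.
Qed.

(* The projection [F] of [g] onto the degrees congruent to 1 modulo 4 makes
   [G dz], with [G = F / z ^ 2], invariant under rotation by [i].  The sum of
   [G dz] over a square around 0 is thus four times the sum over one side, and
   by Goursat's lemma it does not depend on the size of the square. *)
Theorem cauchy_disc g (r M : R) d : 0 < r ->
  (forall z, nrm z < r -> exists d, cderiv g z d) ->
  (forall z, nrm z < r -> nrm (g z) <= M) -> cderiv g 0 d -> nrm d <= 4 * M / r.
Proof.
move=> r0 dg gM dg0.
have M0 : 0 <= M by apply: le_trans (gM 0 _); rewrite ?nrm_ge0 // nrm0.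
have i2 : 'i%C * 'i%C = -1 :> C by rewrite -expr2 sqr_i.
have i0 : 'i%C != 0 :> C by rewrite -nrm_gt0 nrm_i.
pose F z := g z - 'i%C * g ('i%C * z) - g (- z) + 'i%C * g (- ('i%C * z)).
pose G z := F z / z ^+ 2.
have Frot z : F ('i%C * z) = 'i%C * F z.
  have iiz : 'i%C * ('i%C * z) = - z by rewrite mulrA i2 mulN1r.
  rewrite /F iiz opprK.
  have -> : 'i%C * (g z - 'i%C * g ('i%C * z) - g (- z) + 'i%C * g (- ('i%C * z))) =
    'i%C * (g z - g (- z)) - ('i%C * 'i%C) * (g ('i%C * z) - g (- ('i%C * z))) by ring.
  by rewrite i2; ring.
have Grot z : G ('i%C * z) * 'i%C = G z.
  rewrite /G Frot exprMn sqr_i mulN1r invrN.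
  have -> : 'i%C * F z * - (z ^+ 2)^-1 * 'i%C = - ('i%C * 'i%C) * (F z / z ^+ 2) by ring.
  by rewrite i2; ring.
have dF z : nrm z < r -> exists d, cderiv F z d.
  move=> hz.
  have e1 : nrm ('i%C * z) < r by rewrite nrmM nrm_i mul1r.
  have [d1 h1] := dg _ hz; have [d2 h2] := dg _ e1.
  have [|d3 h3] := dg (- z); first by rewrite nrmN.
  have [|d4 h4] := dg (- ('i%C * z)); first by rewrite nrmN.
  eexists; rewrite /F.
  apply: (@cderiv_ext (fun w => g w + (- 'i%C * g ('i%C * w) +
     (-1 * g (-1 * w) + 'i%C * g (- 'i%C * w))))) => [w|].
    by rewrite !mulN1r !mulNr; ring.
  apply: cderivD h1 _; apply: cderivD (cderivZ (- _) (cderiv_scale i0 h2)) _.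
  apply: cderivD; apply: cderivZ; apply: cderiv_scale; rewrite ?oppr_eq0 ?oner_eq0 //.
    by rewrite mulN1r; exact: h3.
  by rewrite mulNr; exact: h4.
have dG z : nrm z < r -> z != 0 -> exists d, cderiv G z d.
  move=> hz z0; have [d1 h1] := dF z hz.
  eexists; apply: (@cderiv_ext (fun w => F w * (w^-1 * w^-1))) => [w|].
    by rewrite /G expr2 invfM.
  by apply: cderivM h1 _; apply: cderivM; exact: cderivV.
(* The constants [g 0] cancel in [F], and each of its four terms has derivative [d] at 0, because
   ['i * 'i = -1]. *)
have dF0 (e : R) : 0 < e -> exists2 s : R, 0 < s &
    forall w, nrm w < s -> nrm (F w - 4 * d * w) <= 4 * e * nrm w.
  move=> e0; have [s s0 hs] := dg0 _ e0; exists s => // w ws.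
  have bnd k : nrm k = 1 -> nrm (g (k * w) - g 0 - d * (k * w)) <= e * nrm w.
    by move=> k1; have := hs (k * w); rewrite subr0 nrmM k1 mul1r; apply.
  have h1 := bnd 1 (nrm1 _); have h2 := bnd _ (nrm_i R).
  have h3 := bnd (-1); have h4 := bnd (- 'i%C).
  rewrite nrmN nrm1 in h3; rewrite nrmN nrm_i in h4.
  have {}h3 := h3 erefl; have {}h4 := h4 erefl.
  rewrite !mul1r in h1; rewrite !mulN1r in h3; rewrite !mulNr in h4.
  have -> : F w - 4 * d * w = (g w - g 0 - d * w)
     + - 'i%C * (g ('i%C * w) - g 0 - d * ('i%C * w))
     + - (g (- w) - g 0 - d * (- w)) + 'i%C * (g (- ('i%C * w)) - g 0 - d * (- ('i%C * w))).
    rewrite /F.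
    have -> : 4 * d * w = 2 * d * w - 2 * ('i%C * 'i%C) * d * w by rewrite i2; ring.
    by ring.
  have k4 := nrmD ((g w - g 0 - d * w)
     + - 'i%C * (g ('i%C * w) - g 0 - d * ('i%C * w))
     + - (g (- w) - g 0 - d * (- w))) ('i%C * (g (- ('i%C * w)) - g 0 - d * (- ('i%C * w)))).
  have k3 := nrmD ((g w - g 0 - d * w)
     + - 'i%C * (g ('i%C * w) - g 0 - d * ('i%C * w)))
     (- (g (- w) - g 0 - d * (- w))).
  have k2 := nrmD (g w - g 0 - d * w)
     (- 'i%C * (g ('i%C * w) - g 0 - d * ('i%C * w))).
  rewrite nrmM nrm_i mul1r in k4; rewrite nrmN in k3; rewrite nrmM nrmN nrm_i mul1r in k2.
  lra.
(* The square of half-side [r / 2] has its corners at distance [r / sqrt 2], inside the disc. *)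
pose rho := r / 2; have rho0 : 0 < rho by rewrite /rho; lra.
have side (eta : R) z : 0 < eta -> rect eta eta (- eta) eta z -> eta <= nrm z.
  move=> eta0 [/andP[z1 z2] _]; have := Re_le_nrm z.
  by have -> : complex.Re z = eta; [lra|rewrite gtr0_norm].
(* [P t] and [Q t] are the ends of the right side of the square of half-side [t]; rotation by ['i]
   takes the first to the second. *)
pose P (t : R) : C := (t -i* t)%C.
pose Q (t : R) : C := (t +i* t)%C.
have QP t : Q t = 'i%C * P t.
  by apply/eqP; rewrite eq_complex /= !mul0r !mul1r sub0r opprK add0r !eqxx.
have PQ t : 0 <= t -> nrm (Q t - P t) = 2 * t.
  move=> t0; have -> : Q t - P t = 'i%C * (2 * t)%:C%C.
    apply/eqP; rewrite eq_complex /=; apply/andP; split; apply/eqP; lra.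
  by rewrite nrmM nrm_i mul1r nrmP; lra.
have Prect eta : 0 <= eta -> rect eta eta (- eta) eta (P eta) by split=> /=; lra.
have Qrect eta : 0 <= eta -> rect eta eta (- eta) eta (Q eta) by split=> /=; lra.
suff main (e : R) : 0 < e -> 4 * nrm d <= 8 * M / rho + e.
  have : 4 * nrm d <= 8 * M / rho by apply/ler_addgt0Pr.
  have -> : 8 * M / rho = 4 * (4 * M / r) by rewrite /rho; field; lra.
  lra.
move=> e0.
have [|s s0 hs] := dF0 (e / 16); first lra.
(* The inner square lies where [F w] is within [4 * (e / 16) * nrm w] of [4 * d * w], so that [G] is
   close to [4 * d / z] on its right side. *)
pose eta := Num.min rho s / 2.
have eta0 : 0 < eta by rewrite divr_gt0 // lt_min rho0.
have [eta_rho eta_s] : eta < rho /\ 2 * eta <= s.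
  have : Num.min rho s <= rho by rewrite ge_min lexx.
  have : Num.min rho s <= s by rewrite ge_min lexx orbT.
  by rewrite /eta; split; lra.
have K_r z : rect eta rho (- rho) rho z -> nrm z < r.
  move=> [/andP[z1 z2] /andP[z3 z4]]; rewrite -(ltr_pXn2r (n:=2)) ?nnegrE ?nrm_ge0 //; last lra.
  rewrite nrm_sqr (_ : r = 2 * rho); last by rewrite /rho; lra.
  by nra.
have dGK z : rect eta rho (- rho) rho z -> exists d, cderiv G z d.
  move=> Kz; apply: dG; first exact: K_r.
  case: Kz => /andP[z1 _] _; apply/eqP => z0; rewrite z0 /= in z1; lra.
have Kp : rect eta rho (- rho) rho (P rho) by split=> /=; lra.
have Kq : rect eta rho (- rho) rho (Q rho) by split=> /=; lra.
have Kp' : rect eta rho (- rho) rho (P eta) by split=> /=; lra.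
have Kq' : rect eta rho (- rho) rho (Q eta) by split=> /=; lra.
have e4 : 0 < e / 4 by lra.
(* A diagonal cuts the trapezoid between the right sides of the two squares into two triangles on
   which [G] is holomorphic. *)
have [N1 h1] := goursat dGK Kp Kq Kq' e4.
have [N2 h2] := goursat dGK Kp Kq' Kp' e4.
pose n := maxn N1 N2.
have {}h1 := h1 n (leq_maxl _ _); have {}h2 := h2 n (leq_maxr _ _).
have outer : nrm (trap G n (P rho) (Q rho)) <= 8 * M / rho.
  have := @trap_bound R (rect rho rho (- rho) rho) G (4 * M / rho ^+ 2) n (P rho) (Q rho).
  rewrite PQ; last lra.
  have -> : 4 * M / rho ^+ 2 * (2 * rho) = 8 * M / rho by field; lra.
  apply; [exact: rect_midpoint| |by apply: Prect; lra|by apply: Qrect; lra].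
  move=> z Kz; have zr := side _ _ rho0 Kz.
  rewrite /G nrmM nrmV; apply: ler_pM; rewrite ?nrm_ge0 ?invr_ge0 ?nrm_ge0 //.
    apply: (rotD_bound gM); apply: K_r.
    by case: Kz => /andP[z1 z2] z3; split=> //; lra.
  have -> : nrm (z ^+ 2) = nrm z ^+ 2 by rewrite !expr2 nrmM.
  have z0 : 0 < nrm z by lra.
  by rewrite lef_pV2 ?posrE ?exprn_gt0 // ler_pXn2r ?nnegrE //; move: zr rho0 z0; clear; lra.
pose r1 z := G z + - (4 * d) * z^-1.
have inner : nrm (trap r1 n (P eta) (Q eta)) <= e / 2.
  have := @trap_bound R (rect eta eta (- eta) eta) r1 (e / 4 / eta) n (P eta) (Q eta).
  rewrite PQ; last lra.
  have -> : e / 4 / eta * (2 * eta) = e / 2 by field; lra.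
  apply; [exact: rect_midpoint| |by apply: Prect; lra|by apply: Qrect; lra].
  move=> z Kz; have zr := side _ _ eta0 Kz.
  have z0 : z != 0 by rewrite -nrm_gt0; lra.
  have -> : r1 z = (F z - 4 * d * z) / (z * z) by rewrite /r1 /G; field.
  rewrite nrmM nrmV nrmM.
  have zs : nrm z < s.
    apply: lt_le_trans eta_s; rewrite -(ltr_pXn2r (n:=2)) ?nnegrE ?nrm_ge0 //; last lra.
    by rewrite nrm_sqr; case: Kz => /andP[z1 z2] /andP[z3 z4]; nra.
  have nz : 0 < nrm z by lra.
  rewrite ler_pdivrMr; last by rewrite mulr_gt0.
  apply: le_trans (hs _ zs) _.
  have k1 : 1 <= nrm z / eta by rewrite ler_pdivlMr // mul1r.
  have -> : e / 4 / eta * (nrm z * nrm z) = e / 4 * nrm z * (nrm z / eta).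
    by field; rewrite gt_eqF.
  have -> : 4 * (e / 16) * nrm z = e / 4 * nrm z by field.
  by rewrite ler_peMr // (mulr_ge0 (ltW e4) (ltW nz)).
have lower : 1 <= nrm (trap (fun z => z^-1) n (P eta) (Q eta)).
  apply: le_trans (le_trans (ler_norm _) (Im_le_nrm _)).
  have := @Im_trap_inv eta n (P eta) (Q eta); rewrite /=.
  have -> : (eta - - eta) / (2 * eta) = 1 by field; lra.
  by apply=> //; move: eta0; clear; lra.
have E1 : trap r1 n (P eta) (Q eta) = trap G n (P eta) (Q eta) +
    - (4 * d) * trap (fun z => z^-1) n (P eta) (Q eta) by rewrite trapD trapZ.
(* The slanted edges of the trapezoid correspond under rotation by ['i], so their contributions
   cancel. *)
have E2 : trap G n (P eta) (Q eta) = trap G n (P rho) (Q rho)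
   - tri G n (P rho) (Q rho) (Q eta) - tri G n (P rho) (Q eta) (P eta).
  rewrite /tri !QP (trap_rot n (P rho) (P eta) Grot).
  rewrite (trap_anti G n (P rho)) (trap_anti G n (P eta) ('i%C * P eta)).
  by rewrite (trap_anti G n (P eta) (P rho)); ring.
have k1 : nrm (4 * d) <= nrm (4 * d * trap (fun z => z^-1) n (P eta) (Q eta)).
  by rewrite [leRHS]nrmM ler_peMr ?nrm_ge0.
have n4 : nrm (4 * d) = 4 * nrm d.
  by rewrite nrmM; congr (_ * _); rewrite -[4](rmorph_nat (real_complex R) 4) nrmP.
have E3 : 4 * d * trap (fun z => z^-1) n (P eta) (Q eta) =
   (trap G n (P rho) (Q rho) - tri G n (P rho) (Q rho) (Q eta)
    - tri G n (P rho) (Q eta) (P eta)) - trap r1 n (P eta) (Q eta).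
  by rewrite E1 -E2; ring.
rewrite E3 n4 in k1.
have := nrmB (trap G n (P rho) (Q rho) - tri G n (P rho) (Q rho) (Q eta)
    - tri G n (P rho) (Q eta) (P eta)) (trap r1 n (P eta) (Q eta)).
have := nrmB (trap G n (P rho) (Q rho) - tri G n (P rho) (Q rho) (Q eta))
    (tri G n (P rho) (Q eta) (P eta)).
have := nrmB (trap G n (P rho) (Q rho)) (tri G n (P rho) (Q rho) (Q eta)).
lra.
Qed.

End Cauchy.

(** * Complex differentials *)

Section Frechet.
Variable R : realType.
Local Notation C := (R[i])%C.

(** Bisection: if the increment over an interval exceeds [K + e] times its length, so does the
    increment over one of its halves. At the common point of the nested intervals this contradicts
    the bound on the derivative. *)
Lemma mean_value_disc (g : C -> C) (K : R) :
  (forall t : R, 0 <= t <= 1 -> exists2 d, cderiv g t%:C%C d & nrm d <= K) ->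
  nrm (g 1 - g 0) <= K.
Proof.
move=> dg; apply/ler_addgt0Pr => e e0; rewrite leNgt; apply/negP => bad.
have h0 (k : nat) : 0 < (2 ^+ k)^-1 :> R by rewrite invr_gt0 exprn_gt0.
pose P k (s : R) := [/\ 0 <= s, s + (2 ^+ k)^-1 <= 1 &
  (K + e) / 2 ^+ k < nrm (g (s + (2 ^+ k)^-1)%:C%C - g s%:C%C)].
have P0 : P 0%N 0.
  by split; rewrite ?expr0 ?invr1 ?add0r ?mulr1 //.
have step k s : exists s', P k s ->
    P k.+1 s' /\ (s <= s' /\ s' + (2 ^+ k.+1)^-1 <= s + (2 ^+ k)^-1).
  have [[s0 s1 Ps]|nP] := pselect (P k s); last by exists s.
  have E : (2 ^+ k)^-1 = (2 ^+ k.+1)^-1 + (2 ^+ k.+1)^-1 :> R.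
    by rewrite exprS invfM; lra.
  have p0 := h0 k.+1.
  rewrite /P; move: s1 Ps; rewrite E; set p := (2 ^+ k.+1)^-1 in E p0 * => s1 Ps.
  have [h|h] := ltP ((K + e) * p) (nrm (g (s + p)%:C%C - g s%:C%C)).
    by exists s => _; split; [split=> //; lra|split; lra].
  exists (s + p) => _; split; [split; [lra|lra|]|split; lra].
  have := nrm_triB (g (s + (p + p))%:C%C) (g (s + p)%:C%C) (g s%:C%C).
  by rewrite addrA in Ps *; lra.
have [f hf] := choice (fun ks : nat * R => step ks.1 ks.2).
pose s := fix s k := if k is k'.+1 then f (k', s k') else 0.
have Ps k : P k (s k) by elim: k => [//|k IH] /=; have [] := hf (k, s k) IH.
have [k|k|l hl] := @nested_intervals R s (fun k => s k + (2 ^+ k)^-1).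
- by have [_ []] := hf (k, s k) (Ps k).
- by rewrite lerDl ltW.
have [|d dgl dK] := dg l.
  by have := hl 0%N; rewrite /= expr0 invr1 add0r.
have [del del0 hdel] := dgl e e0.
have [k hk] := dyadic_small 1 del0; rewrite mul1r in hk.
have [s0 s1] := Ps k; have := hl k; have := h0 k.
set p := (2 ^+ k)^-1 in hk s1 *; rewrite -/p => p0 /andP[l1 l2].
apply/negP; rewrite -leNgt.
have n1 : nrm ((s k)%:C%C - l%:C%C : C) = l - s k by rewrite nrmC -rmorphB nrmP; lra.
have n2 : nrm ((s k + p)%:C%C - l%:C%C : C) = s k + p - l by rewrite -rmorphB nrmP; lra.
have := hdel (s k)%:C%C; have := hdel (s k + p)%:C%C; rewrite n1 n2 => k2 k1.
have {}k1 := k1 ltac:(lra); have {}k2 := k2 ltac:(lra).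
(* The limit point lies between the two ends, so the two linearisation errors add up to at most
   [e * p]. *)
have -> : g (s k + p)%:C%C - g (s k)%:C%C =
  (g (s k + p)%:C%C - g l%:C%C - d * ((s k + p)%:C%C - l%:C%C)) -
  (g (s k)%:C%C - g l%:C%C - d * ((s k)%:C%C - l%:C%C)) + d * p%:C%C.
  by rewrite rmorphD /=; ring.
apply: le_trans (nrmD _ _) _; rewrite nrmM nrmP; last exact: ltW.
apply: le_trans (lerD (nrmB _ _) (ler_wpM2r (ltW p0) dK)) _.
lra.
Qed.

Variable V : normedModType C.

(** Radii of balls are elements of [C]; being positive they are real. *)
Lemma near_nrmP (x : V) (P : set V) : (\forall y \near x, P y) <->
  exists2 del : R, 0 < del & forall y, nrm (y - x) < del -> P y.
Proof.
split=> [/nbhs_ballP[e /= e0 he]|[del del0 hdel]].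
  have eE : e = (complex.Re e)%:C%C by apply/esym/RRe_real/gtr0_real.
  exists (complex.Re e); first by rewrite -ltcR -eE.
  move=> y hy; apply: he; rewrite -ball_normE /ball_ /=.
  by rewrite nrmE eE ltcR nrmC.
apply/nbhs_ballP; exists del%:C%C; first by rewrite /= ltcR.
by move=> y; rewrite -ball_normE /ball_ /= nrmE ltcR nrmC => /hdel.
Qed.

Lemma littleo_nrm (W : normedModType C) (f : V -> W) x : differentiable f x ->
  forall e : R, 0 < e -> exists2 del : R, 0 < del &
  forall w, nrm (w - x) < del -> nrm (f w - f x - 'd f x (w - x)) <= e * nrm (w - x).
Proof.
move=> df e e0; have /eqaddoP := diff_locally df.
have ec : 0 < e%:C%C :> C by rewrite ltcR.
move=> /(_ _ ec)/near_nrmP[del del0 hdel]; exists del => // w hw.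
have := hdel (w - x); rewrite subr0 => /(_ hw) /=.
rewrite !nrmE -rmorphM lecR.
rewrite -[(_ - _ : V -> W) (w - x)]/(f (w - x + x) - (f x + 'd f x (w - x))).
by rewrite subrK opprD addrA.
Qed.

(** Converse of [littleo_nrm], used to recognise the differential of a limit function. The bound on
    [L] supplies the continuity that a differential must have. *)
Lemma diff_nrm (W : normedModType C) (f : V -> W) x (L : {linear V -> W}) (K : R) :
  (forall h, nrm (L h) <= K * nrm h) ->
  (forall e : R, 0 < e -> exists2 del : R, 0 < del &
    forall w, nrm (w - x) < del -> nrm (f w - f x - L (w - x)) <= e * nrm (w - x)) ->
  differentiable f x /\ 'd f x = L :> (V -> W).
Proof.
move=> LK hL.
have Lc : continuous L.
  apply: bounded_linear_continuous; apply/linear_boundedP.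
  exists K%:C%C; split; first by rewrite realE !lecE /= eqxx le_total.
  move=> r Kr y; apply: le_trans (_ : K%:C%C * `|y| <= _).
    by rewrite !nrmE -rmorphM lecR.
  by rewrite ler_wpM2r // ltW.
have hd : f \o shift x = cst (f x) + L +o_ 0 id.
  apply/eqaddoP => e ee.
  have eE : e = (complex.Re e)%:C%C by apply/esym/RRe_real/gtr0_real.
  have e0 : 0 < complex.Re e by rewrite -ltcR -eE.
  have [del del0 hdel] := hL _ e0; apply/near_nrmP; exists del => // h.
  rewrite subr0 => hh; rewrite eE !nrmE -rmorphM lecR.
  have := hdel (h + x); rewrite addrK => /(_ hh).
  by rewrite -[((f \o shift x) - (cst (f x) + L)) h]/(f (h + x) - (f x + L h)) opprD addrA.
have dL := diff_unique Lc hd.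
by split=> //; apply/diff_locallyP; rewrite dL.
Qed.
End Frechet.

(** * One-dimensional slices: Cauchy's estimate and the mean value inequality *)

Section Slices.
Variables (R : realType) (V : normedModType (R[i])%C).
Local Notation C := (R[i])%C.
Implicit Types (f : V -> C^o) (x y v : V).

Lemma cderiv_slice f x v (l : C) : differentiable f (x + l *: v) ->
  cderiv (fun t => f (x + t *: v)) l ('d f (x + l *: v) v).
Proof.
move=> df e e0; set k := nrm v + 1.
have k0 : 0 < k by rewrite ltr_pwDr // nrm_ge0.
have [|s s0 hs] := littleo_nrm df (e := e / k); first by rewrite divr_gt0.
exists (s / k); first by rewrite divr_gt0.
move=> w; rewrite ltr_pdivlMr // => hw.
have E : x + w *: v - (x + l *: v) = (w - l) *: v.
  by rewrite opprD addrACA subrr add0r scalerBl.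
have n0 := nrm_ge0 (w - l).
have := hs (x + w *: v); rewrite E nrmZ linearZ /=.
have k1 : nrm (w - l) * nrm v <= nrm (w - l) * k by rewrite ler_wpM2l // /k lerDl.
rewrite [_ *: 'd f _ v]mulrC => h; apply: le_trans (h _) _; first lra.
have := ler_wpM2l (ltW (divr_gt0 e0 k0)) k1.
by rewrite [X in _ <= X](_ : _ = e * nrm (w - l)) //; field; lra.
Qed.

Lemma cauchy_slice f x v (r M : R) : 0 < r ->
  (forall l : C, nrm l < r -> differentiable f (x + l *: v)) ->
  (forall l : C, nrm l < r -> nrm (f (x + l *: v)) <= M) ->
  nrm ('d f x v) <= 4 * M / r.
Proof.
move=> r0 df fM.
apply: (@cauchy_disc _ (fun t => f (x + t *: v))) => // [l hl|].
  by eexists; apply/cderiv_slice/df.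
have := @cderiv_slice f x v 0; rewrite scale0r addr0; apply.
by have := df 0; rewrite scale0r addr0 nrm0; apply.
Qed.

Lemma cauchy_estimate f x (r M : R) : 0 < r ->
  (forall y, nrm (y - x) < r -> differentiable f y) ->
  (forall y, nrm (y - x) < r -> nrm (f y) <= M) ->
  forall v, nrm ('d f x v) <= 4 * M / r * nrm v.
Proof.
move=> r0 df fM v.
have [->|v0] := eqVneq v 0; first by rewrite linear0 !nrm0 mulr0.
have nv : 0 < nrm v by rewrite nrm_gt0.
have E : 4 * M / r * nrm v = 4 * M / (r / nrm v) by field; rewrite !gt_eqF.
have close (l : C) : nrm l < r / nrm v -> nrm (x + l *: v - x) < r.
  by rewrite addrAC subrr add0r nrmZ ltr_pdivlMr.
rewrite E; apply: cauchy_slice; first by rewrite divr_gt0.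
  by move=> l /close/df.
by move=> l /close/fM.
Qed.

Lemma mean_value f x y (K : R) :
  (forall t : R, 0 <= t <= 1 -> differentiable f (x + t%:C%C *: (y - x))) ->
  (forall t : R, 0 <= t <= 1 -> nrm ('d f (x + t%:C%C *: (y - x)) (y - x)) <= K) ->
  nrm (f y - f x) <= K.
Proof.
move=> df dK.
have := @mean_value_disc _ (fun t => f (x + t *: (y - x))) K.
rewrite scale1r scale0r addr0 (addrC x) subrK; apply => t ht.
exists ('d f (x + t%:C%C *: (y - x)) (y - x)); last exact: dK.
by apply/cderiv_slice/df.
Qed.

Lemma continuous_nrm f x : differentiable f x -> forall e : R, 0 < e ->
  exists2 s : R, 0 < s & forall y, nrm (y - x) < s -> nrm (f y - f x) < e.
Proof.
move=> /differentiable_continuous fc e e0.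
have ec : 0 < e%:C%C :> C by rewrite ltcR.
have /cvgrPdist_lt/(_ _ ec)/near_nrmP[s s0 hs] := fc.
by exists s => // y /hs; rewrite nrmE ltcR nrmC.
Qed.

End Slices.

(** * The Bloch seminorm in terms of real inequalities *)

Section BlochNorm.
Variables (R : realType) (E : completeNormedModType (R[i])%C).
Local Notation C := (R[i])%C.
Implicit Types (f : E -> C^o) (x y v : E).

(** Form of the seminorm bound free of suprema and extended reals; [bloch_seminorm_le] gives the
    equivalence. *)
Definition bloch_le f (K : R) := forall x, nrm x < 1 ->
  forall v, (1 - nrm x ^+ 2) * nrm ('d f x v) <= K * nrm v.

Definition hol f := forall x, nrm x < 1 -> differentiable f x.

Lemma in_unit_ball x : (x \in unit_ball E) = (nrm x < 1).
Proof.
apply/idP/idP => [/set_mem|h]; last apply/mem_set; rewrite /unit_ball /= nrmE;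
  by rewrite (_ : 1 = 1%:C%C) // ltcR.
Qed.

Lemma Re_sqr_norm x : complex.Re (`|x| ^+ 2) = nrm x ^+ 2.
Proof. by rewrite nrmE -rmorphXn. Qed.

Lemma subr_sqr_gt0 x : nrm x < 1 -> 0 < 1 - nrm x ^+ 2.
Proof. by move=> x1; rewrite subr_gt0 expr_lt1 ?nrm_ge0. Qed.

Lemma functional_norm_le (L : {linear E -> C^o}) (K : R) : 0 <= K ->
  (functional_norm L <= K%:E)%E <-> forall v, nrm (L v) <= K * nrm v.
Proof.
move=> K0; split=> [hK v|hK]; last first.
  apply: ge_ereal_sup => _ [v /= v1 <-]; rewrite lee_fin.
  apply: le_trans (hK v) _.
  move: v1; rewrite nrmE (_ : 1 = 1%:C%C) // lecR => v1.
  by rewrite ler_piMr.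
have [->|v0] := eqVneq v 0; first by rewrite linear0 !nrm0 mulr0.
have nv : 0 < nrm v by rewrite nrm_gt0.
have : ((nrm (L ((nrm v)^-1%:C%C *: v)))%:E <= K%:E)%E.
  apply: le_trans hK; apply: ereal_sup_ubound; exists ((nrm v)^-1%:C%C *: v) => //=.
  rewrite nrmE (_ : 1 = 1%:C%C) // lecR nrmZ nrmP ?invr_ge0 ?nrm_ge0 //.
  by rewrite mulVf // gt_eqF.
by rewrite lee_fin linearZ /= nrmZ nrmP ?invr_ge0 ?nrm_ge0 // mulrC ler_pdivrMr.
Qed.

Lemma bloch_seminorm_le f (K : R) : 0 <= K -> (bloch_seminorm f <= K%:E)%E <-> bloch_le f K.
Proof.
move=> K0.
have key x : nrm x < 1 ->
    ((1 - complex.Re (`|x| ^+ 2))%:E * functional_norm ('d f x) <= K%:E)%E <->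
    forall v, (1 - nrm x ^+ 2) * nrm ('d f x v) <= K * nrm v.
  move=> x1; have c0 := subr_sqr_gt0 x1; rewrite Re_sqr_norm.
  rewrite (_ : K%:E = (1 - nrm x ^+ 2)%:E * (K / (1 - nrm x ^+ 2))%:E)%E; last first.
    by rewrite -EFinM; congr _%:E; field; rewrite gt_eqF.
  rewrite lee_pmul2l ?lte_fin // functional_norm_le; last exact: divr_ge0 (ltW c0).
  by split=> h v; have := h v; rewrite mulrAC ler_pdivlMr // mulrC.
split=> [hK x x1|hK].
  apply/key => //; apply: le_trans hK; apply: ereal_sup_ubound; exists x => //.
  by apply/set_mem; rewrite in_unit_ball.
apply: ge_ereal_sup => _ [x /mem_set + <-]; rewrite in_unit_ball => x1.
by apply/key => //; apply: hK.
Qed.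

Lemma bloch_seminorm_ge0 f : (0 <= bloch_seminorm f)%E.
Proof.
have fn0 : (0 <= functional_norm ('d f (0%R : E)))%E.
  by apply: ereal_sup_ubound; exists 0; [rewrite /= normr0 ler01|rewrite linear0 normr0].
have h : ((1 - complex.Re (`|0%R : E| ^+ 2))%:E * functional_norm ('d f (0%R : E)) <=
    bloch_seminorm f)%E.
  apply: ereal_sup_ubound; exists 0 => //.
  by apply/set_mem; rewrite in_unit_ball nrm0.
apply: le_trans h; apply: mule_ge0 => //.
by rewrite lee_fin Re_sqr_norm nrm0 expr0n subr0.
Qed.

Lemma in_blochP f : in_bloch f <-> hol f /\ exists2 K, 0 <= K & bloch_le f K.
Proof.
have HP : (forall x, x \in unit_ball E -> differentiable f x) <-> hol f.
  by split=> h x; have := h x; rewrite in_unit_ball.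
split=> [[/HP hf]|[/HP hf [K K0 hK]]]; last first.
  by split=> //; move/bloch_seminorm_le: hK => /(_ K0) /le_lt_trans; apply; rewrite ltry.
have := bloch_seminorm_ge0 f.
case E1 : (bloch_seminorm f) => [K||] // K0 _; split=> //; exists K => //.
by apply/bloch_seminorm_le; rewrite ?E1.
Qed.

Lemma bloch_norm_bound f (M : R) : (bloch_norm f <= M%:E)%E ->
  [/\ 0 <= M, nrm (f 0) <= M & bloch_le f M].
Proof.
rewrite /bloch_norm -/(nrm (f 0)); have := bloch_seminorm_ge0 f.
case E1 : (bloch_seminorm f) => [K||] //.
rewrite -EFinD !lee_fin => K0 h; have := nrm_ge0 (f 0) => f0.
have M0 : 0 <= M by lra.
split=> //; first lra.
by apply/bloch_seminorm_le; rewrite // E1 lee_fin; lra.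
Qed.

Lemma bloch_norm_lt f (a b e : R) : nrm (f 0) <= a -> 0 <= b -> bloch_le f b -> a + b < e ->
  (bloch_norm f < e%:E)%E.
Proof.
move=> fa b0 /bloch_seminorm_le => /(_ b0) fb ab.
apply: (@le_lt_trans _ _ (a%:E + b%:E)%E); last by rewrite -EFinD lte_fin.
by apply: leeD; rewrite ?lee_fin.
Qed.

End BlochNorm.

(** * Radial derivative and Bloch seminorm *)

Section RadialStep.
Variables (R : realType) (E : completeNormedModType (R[i])%C).
Local Notation C := (R[i])%C.
Implicit Types (f : E -> C^o) (x y z v w : E).

Definition radial_le f (S : R) := forall z, nrm z < 1 ->
  (1 - nrm z ^+ 2) * nrm ('d f z z) <= S.

Lemma radial_le_ge0 f S : radial_le f S -> 0 <= S.
Proof. by move=> /(_ 0); rewrite nrm0 linear0 nrm0 mulr0 => /(_ ltr01). Qed.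

Lemma bloch_radial_le f K : 0 <= K -> bloch_le f K -> radial_le f K.
Proof. by move=> K0 fK z z1; apply: le_trans (fK z z1 z) _; rewrite ler_piMr // ltW. Qed.

(** On the ray through [x], ['d f (a x) x] is the radial derivative at [a x] divided by [a], hence
    at most [S / (s * k)] for [s <= a <= 1]; the mean value inequality concludes. *)
Lemma radial_difference f (S s k : R) x : hol f -> radial_le f S -> 0 < s <= 1 ->
  nrm x < 1 -> 0 < k -> k <= 1 - nrm x ^+ 2 ->
  nrm (f x - f (s%:C%C *: x)) <= (1 - s) * S / (s * k).
Proof.
move=> hf fS /andP[s0 s1] x1 k0 kx; have S0 := radial_le_ge0 fS.
have E1 : x - s%:C%C *: x = (1 - s)%:C%C *: x by rewrite rmorphB scalerBl scale1r.
have tauE t : s%:C%C *: x + t%:C%C *: (x - s%:C%C *: x) = (s + t * (1 - s))%:C%C *: x.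
  by rewrite E1 scalerA -rmorphM -scalerDl -rmorphD.
have tau_s t : 0 <= t <= 1 -> s <= s + t * (1 - s) <= 1.
  move=> /andP[t0 t1].
  have : 0 <= t * (1 - s) by apply: mulr_ge0; lra.
  have : 0 <= (1 - t) * (1 - s) by apply: mulr_ge0; lra.
  lra.
have tau_x (a : R) : s <= a <= 1 -> nrm (a%:C%C *: x) <= nrm x.
  by move=> /andP[sa a1]; rewrite nrmZ nrmP ?ler_piMl ?nrm_ge0 //; lra.
apply: mean_value => t /tau_s ht; rewrite tauE.
  by apply: hf; apply: le_lt_trans (tau_x _ ht) x1.
set a := s + t * (1 - s) in ht *; have /andP[sa a1] := ht.
have a0 : 0 < a by lra.
have lin (c : C) : 'd f (a%:C%C *: x) (c *: x) = c * 'd f (a%:C%C *: x) x.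
  by rewrite linearZ.
rewrite E1 !lin !nrmM !nrmP; try lra.
have := fS (a%:C%C *: x) (le_lt_trans (tau_x _ ht) x1).
rewrite lin nrmM nrmZ !nrmP; try lra.
set D := nrm ('d f _ x) => hS; have D0 : 0 <= D by exact: nrm_ge0.
have ax : k <= 1 - (a * nrm x) ^+ 2.
  apply: le_trans kx _; rewrite lerD2l lerN2 exprMn ler_piMl ?sqr_ge0 //.
  by rewrite expr_le1 // ltW.
have : k * (s * D) <= S.
  apply: le_trans hS; apply: ler_pM => //; [exact: ltW|by rewrite mulr_ge0 // ltW|].
  by rewrite ler_wpM2r.
rewrite mulrA -ler_pdivlMl ?mulr_gt0 // => h.
rewrite -mulrA; apply: ler_wpM2l; first lra.
by rewrite mulrC (mulrC s).
Qed.

(** Cauchy's estimate on the disc of radius [r] for [l |-> f (w + l v) - f (s (w + l v))], whose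
    derivative at 0 is ['d f w v - s * 'd f (s w) v]. *)
Lemma radial_step f (S s k r : R) w v : hol f -> radial_le f S -> 0 < s <= 1 -> 0 < r ->
  0 < k -> (forall l : C, nrm l < r -> k <= 1 - nrm (w + l *: v) ^+ 2) ->
  nrm ('d f w v) <= s * nrm ('d f (s%:C%C *: w) v) + 4 * ((1 - s) * S / (s * k)) / r.
Proof.
move=> hf fS s01 r0 k0 hk; have /andP[s0 s1] := s01.
have in1 (l : C) : nrm l < r -> nrm (w + l *: v) < 1.
  move=> /hk h; rewrite -(@expr_lt1 _ 2) ?nrm_ge0 //; lra.
have in1s (l : C) : nrm l < r -> nrm (s%:C%C *: w + l *: (s%:C%C *: v)) < 1.
  move=> /in1 h; rewrite scalerA mulrC -scalerA -scalerDr nrmZ nrmP; last exact: ltW.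
  by apply: le_lt_trans h; rewrite ler_piMl ?nrm_ge0.
have dE1 := @cderiv_slice _ _ f w v 0.
have dE2 := @cderiv_slice _ _ f (s%:C%C *: w) (s%:C%C *: v) 0.
rewrite !scale0r !addr0 in dE1 dE2.
have h1 : nrm w < 1 by have := in1 0; rewrite nrm0 scale0r addr0; apply.
have h2 : nrm (s%:C%C *: w) < 1 by have := in1s 0; rewrite nrm0 scale0r addr0; apply.
have dD := cderivD (dE1 (hf _ h1)) (cderivZ (-1) (dE2 (hf _ h2))).
have := @cauchy_disc _ _ r ((1 - s) * S / (s * k)) _ r0 _ _ dD.
rewrite linearZ /= mulN1r => h.
apply: le_trans (nrm_leB _ (s%:C%C * 'd f (s%:C%C *: w) v)) _.
rewrite nrmM nrmP ?lerD2l; last exact: ltW.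
apply: h => l hl.
  eexists; apply: cderivD; [|apply: cderivZ]; apply: cderiv_slice; apply: hf.
    exact: in1.
  exact: in1s.
rewrite mulN1r scalerA (mulrC l) -scalerA -scalerDr.
by apply: radial_difference => //; [exact: in1|exact: hk].
Qed.

Lemma unit_vector_bound (L : {linear E -> C^o}) (K : R) :
  (forall v, nrm v = 1 -> nrm (L v) <= K) -> forall v, nrm (L v) <= K * nrm v.
Proof.
move=> LK v; have [->|v0] := eqVneq v 0; first by rewrite linear0 !nrm0 mulr0.
have nv : 0 < nrm v by rewrite nrm_gt0.
have := LK ((nrm v)^-1%:C%C *: v); rewrite linearZ /= !nrmZ nrmP ?invr_ge0 ?nrm_ge0 //.
by rewrite mulVf ?gt_eqF // mulrC ler_pdivrMr // => /(_ erefl).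
Qed.

(** Starting point of the iteration in [radial_small]. The bound [B] depends on [f], but the
    iteration removes it. *)
Lemma diff_bounded_near0 f : hol f -> exists2 del : R, 0 < del & exists2 B : R, 0 <= B &
  forall x, nrm x <= del -> forall v, nrm ('d f x v) <= B * nrm v.
Proof.
move=> hf; have f0 : differentiable f 0 by apply: hf; rewrite nrm0.
have [s s0 hs] := continuous_nrm f0 ltr01.
pose r := Num.min s 1 / 2.
have r0 : 0 < r by rewrite divr_gt0 // lt_min s0 ltr01.
have rs : 2 * r <= s by rewrite mulrC divfK // ge_min lexx.
have r1 : 2 * r <= 1 by rewrite mulrC divfK // ge_min lexx orbT.
exists r => //; exists (4 * (nrm (f 0) + 1) / r).
  by apply: divr_ge0 (ltW r0); apply: mulr_ge0 => //; apply: addr_ge0; rewrite ?nrm_ge0.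
move=> x xr; have near y : nrm (y - x) < r -> nrm y < 2 * r.
  by move=> h; have := nrm_leB y x; lra.
apply: cauchy_estimate => // y /near h; first by apply: hf; lra.
have := hs y; rewrite subr0 => /(_ ltac:(lra)) => h2.
by have := nrm_leB (f y) (f 0); lra.
Qed.

Lemma nrm_lineB w v (l : C) : nrm v = 1 -> nrm (w + l *: v) <= nrm w + nrm l.
Proof. by move=> v1; apply: le_trans (nrmD _ _) _; rewrite nrmZ v1 mulr1. Qed.

(** Repeated halving of the point: each step halves the derivative and adds at most [137 * S], so
    that the errors sum to [274 * S] while the starting bound is divided by [2 ^+ n]. *)
Lemma radial_small f S z v : hol f -> radial_le f S -> nrm v = 1 ->
  nrm z <= 3 / 4 -> nrm ('d f z v) <= 274 * S.
Proof.
move=> hf fS v1; have S0 := radial_le_ge0 fS.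
have [del del0 [B B0 hB]] := diff_bounded_near0 hf.
have main n y : nrm y <= 3 / 4 -> nrm y / 2 ^+ n <= del ->
    nrm ('d f y v) <= B / 2 ^+ n + 274 * S.
  elim: n y => [|n IH] y y34.
    rewrite expr0 !divr1 => yd; have := hB y yd v; rewrite v1; lra.
  rewrite exprS invfM mulrA => yn.
  (* A disc of radius [1 / 8] about a point of norm at most [3 / 4] stays in the ball of radius
     [7 / 8], where [1 - |x|^2 >= 15 / 64]. *)
  have := @radial_step f S 2^-1 (15 / 64) 8^-1 y v hf fS.
  have -> : 4 * ((1 - 2^-1) * S / (2^-1 * (15 / 64))) / 8^-1 = 2048 / 15 * S by field.
  have ny : nrm ((2^-1)%:C%C *: y) = nrm y / 2.
    by rewrite nrmZ nrmP ?invr_ge0 // mulrC.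
  have := IH ((2^-1)%:C%C *: y); rewrite ny => IHy h.
  have y2 : nrm y / 2 <= 3 / 4 by move: y34 (nrm_ge0 y); clear; lra.
  have {}IHy := IHy y2 yn.
  apply: le_trans (h _ _ _ _) _; try by clear; lra.
    move=> l hl; have := nrm_lineB y l v1; have := nrm_ge0 (y + l *: v).
    set t := nrm (y + _) => t0 t1.
    have t2 : t ^+ 2 <= (7 / 8) ^+ 2.
      by rewrite ler_pXn2r ?nnegrE //; move: t1 hl y34; clear; lra.
    by move: t2; clear; lra.
  by move: IHy S0; clear; set p := (2 ^+ n)^-1; lra.
move=> z34; apply: (@le_dyadic _ _ _ B) => k.
(* [n] halvings bring [z] into the ball of radius [del]; [k] further ones make the contribution of
   [B] arbitrarily small. *)
have [n hn] := dyadic_small (nrm z) del0.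
have := main (n + k)%N z z34; rewrite exprD invfM => h.
have i0 m : 0 < (2 ^+ m)^-1 :> R by rewrite invr_gt0 exprn_gt0.
have i1 m : (2 ^+ m)^-1 <= 1 :> R by rewrite invf_le1 ?exprn_gt0 // exprn_ege1 // ler1n.
rewrite addrC; apply: le_trans (h _) _.
  rewrite mulrA; apply: le_trans (ltW hn); by rewrite ler_piMr ?divr_ge0 ?nrm_ge0 ?exprn_ge0.
rewrite lerD2r; apply: ler_wpM2l => //.
by rewrite ler_piMl // ltW.
Qed.

End RadialStep.

Section RadialBloch.
Variables (R : realType) (E : completeNormedModType (R[i])%C).
Local Notation C := (R[i])%C.
Implicit Types (f : E -> C^o) (x y z v w : E).

(** Here [d] is the distance from the point to the sphere, and scaling by [s] doubles it. Since
    [1 - s = d / (1 - d) <= 4 / 3 * d] and [s >= 1 / 2], the quotient stays bounded as [d] tends to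
    0. *)
Lemma contraction_factor (d : R) : 0 < d <= 1 / 4 -> exists s,
  [/\ 0 < s <= 1, s * (1 - d) = 1 - 2 * d &
   forall S, 0 <= S -> (1 - s) * S / (s * (d / 2)) <= 16 / 3 * S].
Proof.
move=> /andP[d0 d1]; pose s := (1 - 2 * d) / (1 - d).
have sE : s * (1 - d) = 1 - 2 * d by rewrite /s divfK // gt_eqF //; lra.
have s12 : 1 / 2 <= s by rewrite /s ler_pdivlMr; lra.
have s1 : s <= 1 by rewrite /s ler_pdivrMr; lra.
exists s; split=> // [|S S0]; first lra.
have sd : 1 - s <= 4 / 3 * d.
  have -> : 1 - s = d / (1 - d) by rewrite /s; field; lra.
  rewrite ler_pdivrMr; last lra.
  have : 0 <= d * (1 / 4 - d) by apply: mulr_ge0; lra.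
  lra.
rewrite ler_pdivrMr; last by apply: mulr_gt0; lra.
have k1 : (1 - s) * S <= 4 / 3 * d * S by apply: ler_wpM2r.
have : 0 <= (s - 1 / 2) * (d * S) by apply: mulr_ge0; [lra|apply: mulr_ge0 => //; lra].
lra.
Qed.

Lemma scale_contract (s d : R) w : 0 < s -> nrm w = 1 - d -> s * (1 - d) = 1 - 2 * d ->
  nrm (s%:C%C *: w) = 1 - 2 * d.
Proof. by move=> s0 wd sd; rewrite nrmZ nrmP ?ltW // wd. Qed.

(* [radial_step] with [1 - |s z| = 2 (1 - |z|)]: each step towards the origin costs
   [C S / (1 - |z|)], half as much as the previous one. *)
Lemma radial_boundary f S z v : hol f -> radial_le f S -> nrm v = 1 -> nrm z < 1 ->
  (1 - nrm z) * nrm ('d f z v) <= 274 * S.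
Proof.
move=> hf fS v1 z1; have S0 := radial_le_ge0 fS.
have small y : nrm y < 1 -> nrm y <= 3 / 4 -> (1 - nrm y) * nrm ('d f y v) <= 274 * S.
  move=> y1 y34; apply: le_trans (radial_small hf fS v1 y34).
  by rewrite ler_piMl ?nrm_ge0 //; have := nrm_ge0 y; lra.
have main n y : nrm y < 1 -> 1 / 4 / 2 ^+ n <= 1 - nrm y ->
    (1 - nrm y) * nrm ('d f y v) <= 274 * S.
  elim: n y => [|n IH] y y1; first by rewrite expr0 divr1 => yn; apply: small => //; lra.
  rewrite exprS invfM mulrA => yn.
  have [y34|y34] := leP (nrm y) (3 / 4); first exact: small.
  pose d := 1 - nrm y; have d01 : 0 < d <= 1 / 4 by rewrite /d; lra.
  have [s [s01 sd hs]] := contraction_factor d01; have /andP[s0 s1] := s01.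
  have yd : nrm y = 1 - d by rewrite /d; lra.
  have sy := scale_contract s0 yd sd; have /andP[d0 d1] := d01.
  have d2 : 0 < d / 2 by lra.
  have := IH (s%:C%C *: y); rewrite sy => IHy.
  have y2 : 1 - 2 * d < 1 by move: d0; clear; lra.
  have {}yn : 1 / 4 / 2 ^+ n <= 1 - (1 - 2 * d).
    by move: yn; rewrite yd; clear; set p := (2 ^+ n)^-1; lra.
  have {}IHy := IHy y2 yn.
  (* On the disc of radius [d / 2] the norm is at most [1 - d / 2], hence [1 - |x|^2 >= d / 2]. *)
  have h : nrm ('d f y v) <= s * nrm ('d f (s%:C%C *: y) v) +
      4 * ((1 - s) * S / (s * (d / 2))) / (d / 2).
    apply: radial_step => // l hl; have := nrm_lineB y l v1; rewrite yd.
    have := nrm_ge0 (y + l *: v); set t := nrm _ => t0 t1.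
    have td : t <= 1 - d / 2 by move: t1 hl; clear; lra.
    have tt : 0 <= t * (1 - t) by apply: mulr_ge0 => //; move: td d0; clear; lra.
    by move: td tt; clear; lra.
  have hS := hs S S0; rewrite yd opprB addrC subrK.
  apply: le_trans (ler_wpM2l (ltW d0) h) _; rewrite mulrDr.
  have -> : d * (4 * ((1 - s) * S / (s * (d / 2))) / (d / 2)) =
    8 * ((1 - s) * S / (s * (d / 2))) by field; rewrite !gt_eqF.
  (* The induction hypothesis carries the weight [2 * d], so it contributes only [137 * S]; the
     error adds at most [128 / 3 * S]. *)
  have : d * (s * nrm ('d f (s%:C%C *: y) v)) <= 137 * S.
    have : s * (d * nrm ('d f (s%:C%C *: y) v)) <= d * nrm ('d f (s%:C%C *: y) v).
      by rewrite ler_piMl // mulr_ge0 ?nrm_ge0 // ltW.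
    by move: IHy; clear; lra.
  by move: hS S0; clear; set A := (1 - s) * S / _; lra.
have [n hn] : exists n, 1 / 4 / 2 ^+ n < 1 - nrm z by apply: dyadic_small; lra.
exact: main (ltW hn).
Qed.

Lemma bloch_of_radial f S : hol f -> radial_le f S -> bloch_le f (548 * S).
Proof.
move=> hf fS z z1; have S0 := radial_le_ge0 fS; have z0 := nrm_ge0 z.
have p : 0 < 1 - nrm z by lra.
have := @unit_vector_bound _ _ ('d f z) (274 * S / (1 - nrm z)).
move=> h v; have {}h := h _ v.
have {}h : nrm ('d f z v) <= 274 * S / (1 - nrm z) * nrm v.
  by apply: h => u u1; rewrite ler_pdivlMr // mulrC; apply: radial_boundary.
apply: le_trans (ler_wpM2l (ltW (subr_sqr_gt0 z1)) h) _.
rewrite mulrA; apply: ler_wpM2r; first exact: nrm_ge0.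
have -> : (1 - nrm z ^+ 2) * (274 * S / (1 - nrm z)) = 274 * S * (1 + nrm z) by field; lra.
have : 274 * S * (1 + nrm z) <= 274 * S * 2 by apply: ler_wpM2l; lra.
lra.
Qed.

(** * Tangential directions and the invariant gradient *)

Variables (ip : E -> E -> C) (Hip : is_inner_product ip).

Lemma ipDl x1 x2 y : ip (x1 + x2) y = ip x1 y + ip x2 y.
Proof. by case: Hip => h _ _; have := h 1 x1 x2 y; rewrite scale1r mul1r. Qed.

Lemma ip0l y : ip 0 y = 0.
Proof. by apply: (addrI (ip 0 y)); rewrite -ipDl !addr0. Qed.

Lemma ipZl a x y : ip (a *: x) y = a * ip x y.
Proof. by case: Hip => h _ _; have := h a x 0 y; rewrite addr0 ip0l addr0. Qed.

Lemma ipC x y : ip y x = (ip x y)^*.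
Proof. by case: Hip. Qed.

Lemma ipDZr v a x y : ip v (x + a *: y) = ip v x + a^* * ip v y.
Proof. by rewrite ipC ipDl ipZl rmorphD rmorphM (ipC x v) (ipC y v). Qed.

Lemma nrm_ipC x y : nrm (ip y x) = nrm (ip x y).
Proof. by rewrite ipC /nrm norm_conjC. Qed.

Lemma ip_nrm x : ip x x = (nrm x ^+ 2)%:C%C.
Proof. by case: Hip => _ _ <-; rewrite nrmE rmorphXn. Qed.

Lemma pythagoras w v (l : C) : ip v w = 0 ->
  nrm (w + l *: v) ^+ 2 = nrm w ^+ 2 + nrm l ^+ 2 * nrm v ^+ 2.
Proof.
move=> vw; have wv : ip w v = 0 by rewrite ipC vw conjC0.
apply: complexI; rewrite -ip_nrm ipDl ipZl !ipDZr vw wv mulr0 addr0 add0r !ip_nrm.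
by rewrite mulrA -normCK nrmE -rmorphXn -rmorphM -rmorphD.
Qed.

(** In a direction orthogonal to the point, moving by [l] changes the squared norm by [|l|^2] only.
    Discs of radius of order [sqrt d] are therefore available at distance [d] from the sphere, and
    the weight [sqrt d] suffices in the iteration of [radial_boundary]. *)
Lemma tangential_bound f M w v : 0 <= M -> hol f -> bloch_le f M -> nrm v = 1 -> ip v w = 0 ->
  nrm w < 1 -> Num.sqrt (1 - nrm w) * nrm ('d f w v) <= 172 * M.
Proof.
move=> M0 hf fM v1 + w1; have fS := bloch_radial_le M0 fM.
have small y : nrm y < 1 -> nrm y <= 3 / 4 ->
    Num.sqrt (1 - nrm y) * nrm ('d f y v) <= 172 * M.
  move=> y1 y34; have y0 := nrm_ge0 y; have D0 := nrm_ge0 ('d f y v).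
  have q1 : Num.sqrt (1 - nrm y) <= 1.
    by rewrite -[leRHS]sqrtr1 ler_wsqrtr //; lra.
  have := fM y y1 v; rewrite v1 mulr1 => h.
  have y2 : nrm y ^+ 2 <= (3 / 4) ^+ 2 by rewrite ler_pXn2r ?nnegrE //; lra.
  have : (1 - (3 / 4) ^+ 2) * nrm ('d f y v) <= (1 - nrm y ^+ 2) * nrm ('d f y v).
    by apply: ler_wpM2r => //; lra.
  have : Num.sqrt (1 - nrm y) * nrm ('d f y v) <= nrm ('d f y v) by rewrite ler_piMl.
  lra.
have main n y : ip v y = 0 -> nrm y < 1 -> 1 / 4 / 2 ^+ n <= 1 - nrm y ->
    Num.sqrt (1 - nrm y) * nrm ('d f y v) <= 172 * M.
  elim: n y => [|n IH] y vy y1; first by rewrite expr0 divr1 => yn; apply: small => //; lra.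
  rewrite exprS invfM mulrA => yn.
  have [y34|y34] := leP (nrm y) (3 / 4); first exact: small.
  pose d := 1 - nrm y; have d01 : 0 < d <= 1 / 4 by rewrite /d; lra.
  have [s [s01 sd hs]] := contraction_factor d01; have /andP[s0 s1] := s01.
  have yd : nrm y = 1 - d by rewrite /d; lra.
  have sy := scale_contract s0 yd sd; have /andP[d0 d1] := d01.
  have d2 : 0 < d / 2 by lra.
  have vy' : ip v (s%:C%C *: y) = 0.
    by rewrite -[_ *: y]add0r ipDZr vy mulr0 addr0 ipC ip0l conjC0.
  have := IH (s%:C%C *: y).
  rewrite sy vy' => IHy.
  have y2 : 1 - 2 * d < 1 by move: d0; clear; lra.
  have {}yn : 1 / 4 / 2 ^+ n <= 1 - (1 - 2 * d).
    by move: yn; rewrite yd; clear; set p := (2 ^+ n)^-1; lra.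
  have {}IHy := IHy erefl y2 yn.
  rewrite (_ : 1 - (1 - 2 * d) = 2 * d) in IHy; last lra.
  rewrite yd (_ : 1 - (1 - d) = d); last lra.
  set q := Num.sqrt d; have q0 : 0 < q by rewrite sqrtr_gt0.
  have qq : q ^+ 2 = d by rewrite sqr_sqrtr // ltW.
  (* The rational [4 / 3] replaces [sqrt 2] as the growth of the weight per step. *)
  have q2 : 4 / 3 * q <= Num.sqrt (2 * d).
    rewrite -(ler_pXn2r (n:=2)) ?nnegrE ?sqrtr_ge0 //; last by move: q0; clear; lra.
    by rewrite exprMn qq sqr_sqrtr; move: d0; clear; lra.
  (* By Pythagoras [1 - |x|^2 >= 2 * d - d ^+ 2 - d / 4] on the disc of radius [q / 2], which
     exceeds [d / 2]. *)
  have h : nrm ('d f y v) <= s * nrm ('d f (s%:C%C *: y) v) +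
      4 * ((1 - s) * M / (s * (d / 2))) / (q / 2).
    apply: radial_step => //; first lra.
    move=> l hl; rewrite pythagoras // v1 expr1n mulr1 yd.
    have l2 : nrm l ^+ 2 <= (q / 2) ^+ 2.
      by rewrite ler_pXn2r ?nnegrE ?nrm_ge0 //; move: hl q0; clear; lra.
    have dd : 0 <= d * (1 / 4 - d) by rewrite mulr_ge0 ?subr_ge0 // ltW.
    by move: l2 dd d0; rewrite exprMn qq; clear; lra.
  have hS := hs M M0.
  apply: le_trans (ler_wpM2l (ltW q0) h) _; rewrite mulrDr.
  have -> : q * (4 * ((1 - s) * M / (s * (d / 2))) / (q / 2)) =
    8 * ((1 - s) * M / (s * (d / 2))) by field; rewrite !gt_eqF.
  set D := nrm ('d f (s%:C%C *: y) v) in IHy *; have D0 : 0 <= D by exact: nrm_ge0.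
  (* The induction hypothesis gives [q * D <= 129 * M], and with the error [128 / 3 * M] the total
     stays below [172 * M]. *)
  have : s * (q * D) <= q * D by rewrite ler_piMl // mulr_ge0 // ltW.
  have := ler_wpM2r D0 q2; move: hS IHy M0; clear.
  by set A := (1 - s) * M / _; lra.
have [n hn] : exists n, 1 / 4 / 2 ^+ n < 1 - nrm w by apply: dyadic_small; lra.
move=> vw; exact: main (ltW hn).
Qed.

(** Split [v] into a multiple of [w], handled by the Bloch bound, and a vector orthogonal to [w],
    handled by [tangential_bound]. The lower bound on [nrm w] controls the division by [nrm w]. *)
Lemma invariant_gradient_bound f M w v : 0 <= M -> hol f -> bloch_le f M ->
  1 / 2 <= nrm w -> nrm w < 1 ->
  nrm ('d f w v) <= M * (2 * nrm (ip v w) / (1 - nrm w ^+ 2) +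
    344 * nrm v / Num.sqrt (1 - nrm w ^+ 2)).
Proof.
move=> M0 hf fM w12 w1.
set c := nrm w in w12 w1 *; have c0 : 0 < c by lra.
have cc : (c ^+ 2)%:C%C != 0 :> C by rewrite -nrm_gt0 nrmP ?exprn_gt0 // ltW // exprn_gt0.
pose a := ip v w / (c ^+ 2)%:C%C.
pose u := v - a *: w.
have uw : ip u w = 0.
  by rewrite /u -scaleNr ipDl ipZl ip_nrm -/c mulNr /a divfK // subrr.
have vE : v = a *: w + u by rewrite /u addrC subrK.
have uv : nrm u <= nrm v.
  rewrite -(ler_pXn2r (n:=2)) ?nnegrE ?nrm_ge0 //.
  have wu : ip w u = 0 by rewrite ipC uw conjC0.
  by rewrite [in leRHS]vE addrC pythagoras // lerDl mulr_ge0 ?sqr_ge0.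
have an : nrm a = nrm (ip v w) / c ^+ 2 by rewrite nrmM nrmV nrmP // ltW // exprn_gt0.
set p := 1 - c ^+ 2; have p0 : 0 < p by exact: subr_sqr_gt0.
have b1 : nrm ('d f w w) <= M * c / p by rewrite ler_pdivlMr // mulrC; apply: fM.
set q := Num.sqrt (1 - c); have q0 : 0 < q by rewrite sqrtr_gt0 subr_gt0.
set t := Num.sqrt p; have t0 : 0 < t by rewrite sqrtr_gt0.
have tq : t <= 2 * q.
  rewrite -(ler_pXn2r (n:=2)) ?nnegrE ?sqrtr_ge0 //; last lra.
  rewrite exprMn !sqr_sqrtr; try lra.
  have : 0 <= (1 - c) ^+ 2 by exact: sqr_ge0.
  rewrite /p; lra.
have b2 : nrm ('d f w u) <= 172 * M / q * nrm u.
  have [->|u0] := eqVneq u 0; first by rewrite linear0 !nrm0 mulr0.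
  have nu : 0 < nrm u by rewrite nrm_gt0.
  have := @tangential_bound f M w ((nrm u)^-1%:C%C *: u) M0 hf fM.
  rewrite nrmZ nrmP ?invr_ge0 ?nrm_ge0 // mulVf ?gt_eqF // ipZl uw mulr0 linearZ /= nrmZ.
  rewrite nrmP ?invr_ge0 ?nrm_ge0 // => /(_ erefl erefl w1); rewrite -/q => h.
  have -> : 172 * M / q * nrm u = 172 * M * (nrm u / q) by ring.
  apply: le_trans (ler_wpM2r (divr_ge0 (ltW nu) (ltW q0)) h).
  by rewrite le_eqVlt; apply/orP; left; apply/eqP; field; rewrite !gt_eqF.
have -> : 'd f w v = a * 'd f w w + 'd f w u by rewrite [in LHS]vE linearD linearZ.
apply: le_trans (nrmD _ _) _; rewrite nrmM mulrDr an; apply: lerD.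
  apply: le_trans (ler_wpM2l _ b1) _; first by rewrite divr_ge0 ?nrm_ge0 ?sqr_ge0.
  have -> : nrm (ip v w) / c ^+ 2 * (M * c / p) = M * (nrm (ip v w) / p) * c^-1.
    by field; rewrite !gt_eqF.
  have -> : M * (2 * nrm (ip v w) / p) = M * (nrm (ip v w) / p) * 2 by rewrite /=; ring.
  apply: ler_wpM2l; first by rewrite mulr_ge0 // divr_ge0 ?nrm_ge0 // ltW.
  by rewrite -(invrK 2) lef_pV2 ?posrE ?invr_gt0 //; lra.
apply: le_trans b2 _.
have -> : M * (344 * nrm v / t) = 172 * M * nrm v * (2 / t) by ring.
have -> : 172 * M / q * nrm u = 172 * M * nrm u * q^-1 by ring.
have M172 : 0 <= 172 * M by exact: mulr_ge0 (ler0n _ 172) M0.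
apply: ler_pM; [exact: mulr_ge0 M172 (nrm_ge0 u)|by rewrite invr_ge0 ltW| |].
  by apply: (ler_wpM2l M172).
by rewrite ler_pdivlMr // mulrC ler_pdivrMr.
Qed.

End RadialBloch.

(** * Lipschitz bounds and ultrafilter limits *)

Section Lipschitz.
Variables (R : realType) (E : completeNormedModType (R[i])%C).
Local Notation C := (R[i])%C.
Implicit Types (f : E -> C^o) (x y z v w : E).

Lemma nrm_segment x y (c t : R) : nrm x <= c -> nrm y <= c -> 0 <= t <= 1 ->
  nrm (x + t%:C%C *: (y - x)) <= c.
Proof.
move=> xc yc /andP[t0 t1].
have -> : x + t%:C%C *: (y - x) = (1 - t)%:C%C *: x + t%:C%C *: y.
  by rewrite scalerBr rmorphB scalerBl scale1r addrA addrAC.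
apply: le_trans (nrmD _ _) _; rewrite !nrmZ !nrmP //; last lra.
have := ler_wpM2l t0 yc; have := @ler_wpM2l _ (1 - t) _ _ _ xc; lra.
Qed.

Lemma bloch_diff_le f (K c : R) x v : 0 <= K -> bloch_le f K -> nrm x <= c -> c < 1 ->
  nrm ('d f x v) <= K / (1 - c) * nrm v.
Proof.
move=> K0 fK xc c1; have x0 := nrm_ge0 x; have := fK x (le_lt_trans xc c1) v.
have : (1 - c) * nrm ('d f x v) <= (1 - nrm x ^+ 2) * nrm ('d f x v).
  apply: ler_wpM2r; first exact: nrm_ge0.
  have : 0 <= nrm x * (1 - nrm x) by apply: mulr_ge0; lra.
  lra.
move=> h1 h2; rewrite mulrAC ler_pdivlMr; last lra.
by rewrite mulrC (le_trans h1).
Qed.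

Lemma bloch_lip f (K c : R) x y : 0 <= K -> hol f -> bloch_le f K ->
  nrm x <= c -> nrm y <= c -> c < 1 -> nrm (f x - f y) <= K / (1 - c) * nrm (x - y).
Proof.
move=> K0 hf fK xc yc c1; apply: mean_value => t ht.
  by apply: hf; apply: le_lt_trans c1; apply: nrm_segment.
by apply: bloch_diff_le => //; apply: nrm_segment.
Qed.

Lemma cderiv_diffB f x y v : differentiable f x -> differentiable f y ->
  cderiv (fun t : C => f (x + t *: v) - f (y + t *: v)) 0 ('d f x v - 'd f y v).
Proof.
move=> fx fy; have := @cderiv_slice _ _ f x v 0; have := @cderiv_slice _ _ f y v 0.
rewrite !scale0r !addr0 => /(_ fy) hy /(_ fx) hx.
have := cderivD hx (cderivZ (-1) hy); rewrite mulN1r.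
by apply: cderiv_ext => w; rewrite mulN1r.
Qed.

(* Cauchy's estimate for [t |-> f (x + t v) - f (y + t v)]. *)
Lemma bloch_diff_lip f (K c : R) x y v : 0 <= K -> hol f -> bloch_le f K ->
  nrm x <= c -> nrm y <= c -> c < 1 ->
  nrm ('d f x v - 'd f y v) <= 16 * K / (1 - c) ^+ 2 * nrm (x - y) * nrm v.
Proof.
move=> K0 hf fK xc yc c1.
have [->|v0] := eqVneq v 0.
  by rewrite (linear0 ('d f x)) (linear0 ('d f y)) subrr !nrm0 mulr0.
have nv : 0 < nrm v by rewrite nrm_gt0.
(* Half the distance to the sphere: translates by less than [b] keep norm at most [c + b], and
   [1 - (c + b) = b]. *)
pose b := (1 - c) / 2; have b0 : 0 < b by rewrite /b; lra.
have near u (l : C) : nrm u <= c -> nrm l < b / nrm v -> nrm (u + l *: v) <= c + b.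
  rewrite ltr_pdivlMr // => uc lb; apply: le_trans (nrmD _ _) _; rewrite nrmZ; lra.
have hol_near u (l : C) : nrm u <= c -> nrm l < b / nrm v -> differentiable f (u + l *: v).
  by move=> uc /(near _ _ uc) h; apply: hf; rewrite /b in h; lra.
have fx : differentiable f x by apply: hf; lra.
have fy : differentiable f y by apply: hf; lra.
have r0 : 0 < b / nrm v by apply: divr_gt0.
have := @cauchy_disc _ _ (b / nrm v) (K / (1 - (c + b)) * nrm (x - y)) _ r0 _ _
   (cderiv_diffB v fx fy).
have -> : 4 * (K / (1 - (c + b)) * nrm (x - y)) / (b / nrm v) =
   16 * K / (1 - c) ^+ 2 * nrm (x - y) * nrm v.
  have -> : 1 - (c + b) = b by rewrite /b; lra.
  by rewrite (_ : 1 - c = 2 * b); [field; rewrite !gt_eqF|rewrite /b; lra].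
apply => l hl.
  eexists; apply: cderivD; first by apply/cderiv_slice/hol_near.
  apply: (@cderiv_ext _ (fun t => -1 * f (y + t *: v))) => [w|]; first by rewrite mulN1r.
  by apply: cderivZ; apply/cderiv_slice/hol_near.
have := @bloch_lip f K (c + b) (x + l *: v) (y + l *: v) K0 hf fK (near _ _ xc hl) (near _ _ yc hl).
have -> : x + l *: v - (y + l *: v) = x - y by rewrite opprD addrACA subrr addr0.
by apply; rewrite /b; lra.
Qed.

(** Mean value inequality for [t |-> f (x + t v) - t * 'd f x v], whose derivative is controlled by
    [bloch_diff_lip]. The constant depends on [f] only through [K], so the bound survives limits. *)
Lemma bloch_taylor f (K c : R) x y : 0 <= K -> hol f -> bloch_le f K ->
  nrm x <= c -> nrm y <= c -> c < 1 ->
  nrm (f y - f x - 'd f x (y - x)) <= 16 * K / (1 - c) ^+ 2 * nrm (y - x) ^+ 2.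
Proof.
move=> K0 hf fK xc yc c1; set v := y - x.
have := @mean_value_disc _ (fun t => f (x + t *: v) + - 'd f x v * t)
  (16 * K / (1 - c) ^+ 2 * nrm v ^+ 2).
rewrite scale1r scale0r !addr0 {1}/v (addrC x) subrK mulr1 mulr0 addr0.
rewrite addrAC; apply => t ht.
have tc := nrm_segment xc yc ht.
exists ('d f (x + t%:C%C *: v) v + - 'd f x v * 1).
  apply: cderivD; first by apply/cderiv_slice/hf; exact: le_lt_trans c1.
  apply: cderivZ => e e0; exists 1 => // w _.
  by rewrite mul1r subrr nrm0 mulr_ge0 ?nrm_ge0 // ltW.
rewrite mulr1; apply: le_trans (bloch_diff_lip v K0 hf fK tc xc c1) _.
rewrite addrAC subrr add0r nrmZ -mulrA expr2; case/andP: ht => t0 t1.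
apply: ler_wpM2l; first by rewrite divr_ge0 ?sqr_ge0 ?mulr_ge0.
apply: ler_wpM2r; first exact: nrm_ge0.
by rewrite nrmP // ler_piMl ?nrm_ge0.
Qed.

End Lipschitz.

(** * Limits of bounded sequences along an ultrafilter *)

Section UltraLimit.
Variables (R : realType) (U : set_system nat) (FU : UltraFilter U).
Local Notation C := (R[i])%C.
Implicit Types (x y : nat -> C).

Definition ulim x (l : C) := forall e : R, 0 < e -> U [set n | nrm (x n - l) < e].

Lemma bounded_ulimR (x : nat -> R) (B : R) : (forall n, `|x n| <= B) ->
  exists l, forall e : R, 0 < e -> U [set n | `|x n - l| < e].
Proof.
move=> xB; have UF : ProperFilter U by exact: ultra_proper.
have := @segment_compact R (- B) B (x @ U) _.
case.
  apply: (@filterS _ U _ setT); last exact: filterT.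
  by move=> n _ /=; rewrite in_itv /= -ler_norml.
move=> l [_ cl]; exists l => e e0.
have [//|h] := in_ultra_setVsetC [set n | `|x n - l| < e] FU.
have := cl (x @` (~` [set n | `|x n - l| < e])) (ball l e).
case; first by apply: (@filterS _ U _ _ _ _ h) => n hn; exists n.
  exact: nbhsx_ballx.
move=> _ [[n hn <-]]; rewrite /ball /= => hb; exfalso; apply: hn => /=.
by rewrite distrC.
Qed.

Lemma bounded_ulim x (B : R) : (forall n, nrm (x n) <= B) -> exists l, ulim x l.
Proof.
move=> xB.
have [l1 h1] := @bounded_ulimR (fun n => complex.Re (x n)) B
  (fun n => le_trans (Re_le_nrm _) (xB n)).
have [l2 h2] := @bounded_ulimR (fun n => complex.Im (x n)) B
  (fun n => le_trans (Im_le_nrm _) (xB n)).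
exists (l1 +i* l2)%C => e e0; have e2 : 0 < e / 2 by lra.
apply: filterS (filterI (h1 _ e2) (h2 _ e2)) => n [/= k1 k2].
apply: le_lt_trans (nrm_le_ReIm _) _; rewrite !raddfB /=; lra.
Qed.

Lemma ulim_le x l (B : R) : (forall n, nrm (x n) <= B) -> ulim x l -> nrm l <= B.
Proof.
move=> xB xl; apply/ler_addgt0Pr => e e0.
have [n /= hn] := filter_ex (xl e e0).
by have := nrm_leB l (x n); have := xB n; rewrite (nrmC l); lra.
Qed.

Lemma ulimD x y l m : ulim x l -> ulim y m -> ulim (fun n => x n + y n) (l + m).
Proof.
move=> xl ym e e0; have e2 : 0 < e / 2 by lra.
apply: filterS (filterI (xl _ e2) (ym _ e2)) => n [/= k1 k2].
rewrite opprD addrACA; apply: le_lt_trans (nrmD _ _) _; lra.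
Qed.

Lemma ulimZ (a : C) x l : ulim x l -> ulim (fun n => a * x n) (a * l).
Proof.
move=> xl e e0; have a1 : 0 < nrm a + 1 by rewrite ltr_pwDr // nrm_ge0.
apply: filterS (xl _ (divr_gt0 e0 a1)) => n /=; rewrite ltr_pdivlMr // => h.
rewrite -mulrBr nrmM; apply: le_lt_trans h; rewrite mulrC.
by apply: ler_wpM2l; rewrite ?nrm_ge0 // lerDl.
Qed.

Lemma ulimB x y l m : ulim x l -> ulim y m -> ulim (fun n => x n - y n) (l - m).
Proof.
move=> xl /(ulimZ (-1)) ym; have := ulimD xl ym; rewrite mulN1r.
by under eq_fun do rewrite mulN1r.
Qed.

Lemma ulim_unique x l m : ulim x l -> ulim x m -> l = m.
Proof.
move=> xl xm; apply/eqP; rewrite -subr_eq0; apply/eqP/nrm_eq0/le_anti.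
rewrite nrm_ge0 andbT; apply: ulim_le (ulimB xl xm) => n.
by rewrite subrr nrm0.
Qed.

End UltraLimit.

(** * Finite colourings of relatively compact sets *)

Section Colouring.
Variables (R : realType) (E : completeNormedModType (R[i])%C).
Local Notation C := (R[i])%C.

(** Total boundedness, phrased with colours because colourings for several maps combine by taking
    tuples. *)
Lemma finite_colouring (A : set E) (e : R) : compact (closure A) -> 0 < e ->
  exists (T : finType) (c : E -> T), forall x y, A x -> A y -> c x = c y -> nrm (x - y) < e.
Proof.
move=> Ac e0; have e2 : 0 < (e / 2)%:C%C :> C by rewrite ltcR; lra.
move: Ac; rewrite compact_cover => /(_ E setT (fun i => ball i (e / 2)%:C%C)) [i _||D _ hD].
- exact: ball_open.
- by move=> x _; exists x => //; exact: ballxx.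
have hA x : A x -> exists i : D, nrm (x - val i) < e / 2.
  move=> /(@subset_closure _ A)/hD[i /= iD]; rewrite -ball_normE /ball_ /= nrmE ltcR nrmC.
  by move=> h; exists [` iD]%fset.
(* [None] is the colour of points outside all the chosen balls; no point of [A] receives it. *)
exists (option D), (fun x => [pick i : D | nrm (x - val i) < e / 2]) => x y Ax Ay.
case: pickP => [i xi|no]; last by have [i hi] := hA x Ax; have := no i; rewrite hi.
case: pickP => [j yj [ij]|//]; rewrite -ij in yj.
have := nrm_triB x (val i) y; rewrite (nrmC (val i)); lra.
Qed.

Lemma compact_nrm_bounded (A : set E) : compact (closure A) ->
  exists2 B : R, 0 <= B & forall x, A x -> nrm x <= B.
Proof.
move=> Ac; have [T [c hc]] := finite_colouring Ac ltr01.
have rep t : exists r, forall x, A x -> c x = t -> A r /\ c r = t.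
  have [[x [Ax xt]]|no] := pselect (exists x, A x /\ c x = t); first by exists x.
  by exists 0 => x Ax xt; exfalso; apply: no; exists x.
have [r hr] := choice rep.
exists (1 + \sum_(t : T) nrm (r t)); first by rewrite addr_ge0 ?sumr_ge0 // => t _; exact: nrm_ge0.
move=> x Ax; have [Ar cr] := hr (c x) x Ax erefl.
have : nrm (r (c x)) <= \sum_(t : T) nrm (r t).
  by rewrite (bigD1 (c x)) //= lerDl sumr_ge0 // => t _; exact: nrm_ge0.
have := nrm_leB x (r (c x)); have := hc _ _ Ax Ar (esym cr); lra.
Qed.

End Colouring.

(** * Composition operators *)

Section BlochUltraLimit.
Variables (R : realType) (U : set_system nat) (FU : UltraFilter U).
Variable E : completeNormedModType (R[i])%C.
Local Notation C := (R[i])%C.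

(** Values and derivatives are bounded at each point, so they converge along [U]. The limit of the
    derivatives is linear, and the uniform Taylor bound passes to the limit and shows that it is the
    differential of [g]. *)
Lemma bloch_ulim (h : nat -> E -> C^o) (K B : R) : 0 <= K ->
  (forall n, hol (h n)) -> (forall n, bloch_le (h n) K) -> (forall n, nrm (h n 0) <= B) ->
  exists g : E -> C^o, [/\ hol g, bloch_le g K,
    forall z, nrm z < 1 -> ulim U (fun n => h n z) (g z) &
    forall z v, nrm z < 1 -> ulim U (fun n => 'd (h n) z v) ('d g z v)].
Proof.
move=> K0 hh hK hB.
have lim z : exists l : C^o, nrm z < 1 -> ulim U (fun n => h n z) l.
  have [z1|_] := ltP (nrm z) 1; last by exists 0.
  have [|l hl] := @bounded_ulim R U FU (fun n => h n z) (B + K / (1 - nrm z) * nrm z).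
    move=> n; apply: le_trans (nrm_leB _ (h n 0)) _; apply: lerD => //.
    have := @bloch_lip _ _ (h n) K (nrm z) z 0 K0 (hh n) (hK n).
    by rewrite subr0 nrm0; apply => //; exact: nrm_ge0.
  by exists l.
have [g hg] := choice lim.
have dlim (zv : E * E) : exists l : C^o, nrm zv.1 < 1 -> ulim U (fun n => 'd (h n) (zv.1) (zv.2)) l.
  have [z1|_] := ltP (nrm zv.1) 1; last by exists 0.
  have [n|l hl] := @bounded_ulim R U FU (fun n => 'd (h n) (zv.1) (zv.2))
    (K / (1 - nrm zv.1) * nrm zv.2); last by exists l.
  exact: bloch_diff_le.
have [L hL] := choice dlim.
have dg z : nrm z < 1 -> differentiable g z /\ forall v, 'd g z v = L (z, v).
  move=> z1; have hLz v := hL (z, v) z1.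
  have lin : linear (fun v => L (z, v) : C^o).
    move=> a x y; apply: (ulim_unique FU (hLz _)).
    have := ulimD FU (ulimZ FU a (hLz x)) (hLz y).
    by under eq_fun do rewrite -[_ * _]/(_ *: _) -linearP.
  pose LL : {linear E -> C^o} :=
    HB.pack (fun v => L (z, v) : C^o) (GRing.isLinear.Build C E C^o *:%R _ lin).
  have [||dgz dE] := @diff_nrm R E C^o g z LL (K / (1 - nrm z)).
  - move=> v; apply: (ulim_le FU _ (hLz v)) => n.
    exact: bloch_diff_le.
  - move=> e e0; pose c := (1 + nrm z) / 2.
    have c1 : c < 1 by rewrite /c; lra.
    have zc : nrm z <= c by rewrite /c; lra.
    pose k := 16 * K / (1 - c) ^+ 2.
    have k0 : 0 <= k by rewrite divr_ge0 ?sqr_ge0 ?mulr_ge0.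
    (* The first bound keeps [w] in the ball of radius [c]; the second turns the quadratic remainder
       into [e * nrm (w - z)]. *)
    exists (Num.min (c - nrm z) (e / (k + 1))).
      by rewrite lt_min divr_gt0 ?andbT //; [rewrite /c|]; lra.
    move=> w; rewrite lt_min => /andP[wc we].
    have {}wc : nrm w <= c by have := nrm_leB w z; lra.
    apply: le_trans (_ : k * nrm (w - z) ^+ 2 <= _).
      have w1 := le_lt_trans wc c1.
      apply: (ulim_le FU _ (ulimB FU (ulimB FU (hg w w1) (hg z z1)) (hLz (w - z)))) => n.
      exact: bloch_taylor.
    rewrite expr2 mulrA; apply: ler_wpM2r; first exact: nrm_ge0.
    rewrite ltr_pdivlMr in we; last lra.
    by have := nrm_ge0 (w - z); lra.
  by split=> // v; rewrite dE.
exists g; split=> //.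
- by move=> z /dg[].
- move=> z z1 v; have [_ ->] := dg z z1.
  rewrite -ler_pdivlMl ?subr_sqr_gt0 //; apply: (ulim_le FU _ (hL (z, v) z1)) => n /=.
  by rewrite ler_pdivlMl ?subr_sqr_gt0 //; apply: hK.
- by move=> z v z1; have [_ e] := dg z z1; have := hL (z, v) z1; rewrite -(e v).
Qed.

End BlochUltraLimit.

(** * Composition with [phi]: boundedness and limits *)

Section Composition.
Variables (R : realType) (E : completeNormedModType (R[i])%C).
Local Notation C := (R[i])%C.
Variables (ip : E -> E -> C) (Hip : is_inner_product ip) (phi : E -> E).
Hypothesis phi1 : forall z, nrm z < 1 -> nrm (phi z) < 1.
Hypothesis dphi : forall z, nrm z < 1 -> differentiable phi z.

(** The weighted radial derivative of [phi]. By the chain rule, ['d f (phi z) (V z)] is the weighted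
    radial derivative of [f \o phi]. *)
Let V (z : E) : E := (1 - `|z| ^+ 2) *: 'd phi z z.
Let S (delta : R) : set E := [set z | nrm z < 1 /\ nrm (phi z) <= delta].

Hypothesis inner : forall delta : R, 0 < delta < 1 ->
  compact (closure (phi @` S delta)) /\ compact (closure (V @` S delta)).
(** Conditions (ii) and (iii) with a common radius, the weight being absorbed into [V]. *)
Hypothesis outer : forall e : R, 0 < e -> exists2 r : R, r < 1 &
  forall z, nrm z < 1 -> r < nrm (phi z) ->
    nrm (V z) / Num.sqrt (1 - nrm (phi z) ^+ 2) < e /\
    nrm (ip (V z) (phi z)) / (1 - nrm (phi z) ^+ 2) < e.

Lemma comp_hol (f : E -> C^o) : hol f -> hol (f \o phi).
Proof. by move=> hf z z1; apply: differentiable_comp; [exact: dphi|exact/hf/phi1]. Qed.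

Lemma comp_radial (f : E -> C^o) z : hol f -> nrm z < 1 ->
  (1 - nrm z ^+ 2)%:C%C * 'd (f \o phi) z z = 'd f (phi z) (V z).
Proof.
move=> hf z1; rewrite diff_comp; [|exact: dphi|exact/hf/phi1].
rewrite /V nrmE -rmorphXn -(rmorph1 (real_complex R)) -rmorphB.
have lin (c : C) v : 'd f (phi z) (c *: v) = c * 'd f (phi z) v by rewrite linearZ.
by rewrite lin.
Qed.

(** Both terms of [invariant_gradient_bound] are small by [outer], and [346 = 2 + 344]. The radius
    is raised to at least [1 / 2] to make that bound applicable. *)
Lemma outer_bound (e : R) : 0 < e -> exists2 delta : R, 0 < delta < 1 &
  forall z, nrm z < 1 -> delta < nrm (phi z) ->
  forall (f : E -> C^o) M, 0 <= M -> hol f -> bloch_le f M ->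
  nrm ('d f (phi z) (V z)) <= M * (346 * e).
Proof.
move=> e0; have [r r1 hr] := outer e0.
exists (Num.max r (1 / 2)).
  by rewrite gt_max r1 lt_max; apply/andP; split; [apply/orP; right|]; lra.
move=> z z1; rewrite gt_max => /andP[rz z12] f M M0 hf fM.
have [h1 h2] := hr z z1 rz.
apply: le_trans (invariant_gradient_bound Hip _ M0 hf fM (ltW z12) (phi1 z1)) _.
apply: ler_wpM2l => //; rewrite -!mulrA; lra.
Qed.

Lemma inner_bound (delta : R) : 0 < delta < 1 -> exists2 B : R, 0 <= B &
  forall z, S delta z -> nrm (V z) <= B.
Proof.
move=> /inner[_ /compact_nrm_bounded[B B0 hB]]; exists B => // z Sz.
by apply: hB; exists z.
Qed.

Lemma inner_colouring (delta e : R) : 0 < delta < 1 -> 0 < e ->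
  exists (T : finType) (c : E -> T), forall x y, S delta x -> S delta y -> c x = c y ->
  nrm (phi x - phi y) < e /\ nrm (V x - V y) < e.
Proof.
move=> /inner[c1 c2] e0.
have [T1 [k1 h1]] := finite_colouring c1 e0; have [T2 [k2 h2]] := finite_colouring c2 e0.
exists (T1 * T2)%type, (fun x => (k1 (phi x), k2 (V x))) => x y Sx Sy [e1 e2].
by split; [apply: h1 e1|apply: h2 e2]; [exists x|exists y|exists x|exists y].
Qed.

(** By [bloch_of_radial] only the radial derivative matters. It is bounded by [outer_bound] where
    [phi z] is near the sphere, and elsewhere because both [V] and the derivative of [f] are
    bounded. *)
Lemma comp_bloch : exists2 K : R, 0 <= K & forall (f : E -> C^o) M, 0 <= M -> hol f ->
  bloch_le f M -> bloch_le (f \o phi) (K * M).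
Proof.
have [d d01 hd] := outer_bound ltr01; have [B B0 hB] := inner_bound d01.
have /andP[d0 d1] := d01; have Bd : 0 <= B / (1 - d) by apply: divr_ge0 => //; lra.
exists (548 * (346 + B / (1 - d))); first by apply: mulr_ge0; lra.
move=> f M M0 hf fM; rewrite -mulrA; apply: bloch_of_radial; first exact: comp_hol.
move=> z z1; rewrite -[X in X * _]nrmP; last exact: ltW (subr_sqr_gt0 z1).
  rewrite -nrmM comp_radial //.
have [zd|zd] := leP (nrm (phi z)) d.
  apply: le_trans (bloch_diff_le _ M0 fM zd d1) _.
  apply: le_trans (ler_wpM2l _ (hB z (conj z1 zd))) _; first by apply: divr_ge0 => //; lra.
  have -> : M / (1 - d) * B = B / (1 - d) * M by ring.
  by apply: ler_wpM2r => //; lra.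
apply: le_trans (hd z z1 zd f M M0 hf fM) _.
by rewrite mulrC; apply: ler_wpM2r => //; lra.
Qed.

Variables (U : set_system nat) (FU : UltraFilter U).

(** The limit along [U] is first pointwise. It is uniform for the weighted radial derivatives, since
    these are small near the sphere and, by the colouring, determined up to a small error at
    finitely many points elsewhere. *)
Lemma comp_ulim (u : nat -> E -> C^o) (M : R) : 0 <= M ->
  (forall n, [/\ hol (u n), nrm (u n 0) <= M & bloch_le (u n) M]) ->
  exists g : E -> C^o, [/\ hol g, exists2 K, 0 <= K & bloch_le g K &
    forall e : R, 0 < e -> U [set n | (bloch_norm ((u n \o phi) - g)%R < e%:E)%E]].
Proof.
move=> M0 hu; have [K K0 hK] := comp_bloch.
have hh n : hol (u n \o phi) by apply: comp_hol; have [] := hu n.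
have hb n : bloch_le (u n \o phi) (K * M) by have [? _ ?] := hu n; apply: hK.
have KM0 : 0 <= K * M by exact: mulr_ge0.
pose B := M + M / (1 - nrm (phi 0)) * nrm (phi 0).
have p0 : nrm (phi 0) < 1 by apply: phi1; rewrite nrm0.
have h0 n : nrm ((u n \o phi) 0) <= B.
  have [hn u0 bn] := hu n.
  apply: le_trans (nrm_leB _ (u n 0)) _; apply: lerD => //.
  have := @bloch_lip _ _ (u n) M (nrm (phi 0)) (phi 0) 0 M0 hn bn.
  by rewrite subr0 nrm0; apply => //; exact: nrm_ge0.
have [g [hg gK limg limdg]] := bloch_ulim FU KM0 hh hb h0.
exists g; split=> //; first by exists (K * M).
pose X n z := 'd (u n) (phi z) (V z).
pose Y z := (1 - nrm z ^+ 2)%:C%C * 'd g z z.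
have limX z : nrm z < 1 -> ulim U (X^~ z) (Y z).
  move=> z1; have := ulimZ FU (1 - nrm z ^+ 2)%:C%C (limdg z z z1).
  rewrite (_ : (fun n => _) = X^~ z) //; apply/funext => n.
  by rewrite comp_radial //; have [] := hu n.
have XYE n z : nrm z < 1 ->
    (1 - nrm z ^+ 2) * nrm ('d ((u n \o phi) - g) z z) = nrm (X n z - Y z).
  move=> z1; have dB : 'd ((u n \o phi) - g) z z = 'd (u n \o phi) z z - 'd g z z :> C.
    exact: (congr1 (fun F : E -> C^o => F z) (diffB (hh n z z1) (hg z z1))).
  have -> : X n z - Y z = (1 - nrm z ^+ 2)%:C%C * ('d (u n \o phi) z z - 'd g z z : C).
    rewrite mulrBr; congr (_ - _); rewrite comp_radial //.
    by have [] := hu n.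
  rewrite nrmM nrmP; last exact: ltW (subr_sqr_gt0 z1).
  exact: (congr1 (fun t : C => (1 - nrm z ^+ 2) * nrm t) dB).
have radial s : 0 < s -> U [set n | radial_le ((u n \o phi) - g)%R s].
  move=> s0; have M1 : 0 < M + 1 by lra.
  (* Chosen so that [M * (346 * _) <= s / 2]: near the sphere the derivatives and their limit are
     each at most [s / 2]. Using [M + 1] covers the case [M = 0]. *)
  have [|d d01 hd] := @outer_bound (s / (692 * (M + 1))).
    by apply: divr_gt0; [exact: s0|lra].
  have [D D0 hD] := inner_bound d01; have /andP[d0 d1] := d01.
  (* Oscillation of [X n] per unit of [e]: the first term comes from varying [V], the second from
     varying the base point [phi z]. *)
  pose k := M / (1 - d) + 16 * M / (1 - d) ^+ 2 * D.
  have Md : 0 <= M / (1 - d) by apply: divr_ge0 => //; lra.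
  have k0 : 0 <= k.
    by apply: addr_ge0 => //; apply: mulr_ge0 => //; rewrite divr_ge0 ?sqr_ge0 ?mulr_ge0.
  pose e := s / (3 * (k + 1)).
  have e0 : 0 < e by apply: divr_gt0 => //; apply: mulr_gt0 => //; lra.
  have ke : k * e <= s / 3.
    have : (k + 1) * e = s / 3 by rewrite /e; field; lra.
    lra.
  have [T [c hc]] := inner_colouring d01 e0.
  have rep t : exists r, forall z, S d z -> c z = t -> S d r /\ c r = t.
    have [[x [Sx xt]]|no] := pselect (exists x, S d x /\ c x = t); first by exists x.
    by exists 0 => x Sx xt; exfalso; apply: no; exists x.
  have [r hr] := choice rep.
  have s3 : 0 < s / 3 by lra.
  (* There are finitely many colours, so the sets of good indices can be intersected within [U]. *)
  have UT : U [set n | forall t, S d (r t) -> nrm (X n (r t) - Y (r t)) < s / 3].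
    apply: (@filter_forall nat T (fun t n => S d (r t) -> nrm (X n (r t) - Y (r t)) < s / 3)) => t.
    have [Sr|nS] := pselect (S d (r t)); last by apply: filterE => n /nS.
    by apply: filterS (limX _ Sr.1 _ s3) => n hn _.
  have lipX n x y : S d x -> S d y -> c x = c y -> nrm (X n x - X n y) <= s / 3.
    move=> Sx Sy cxy; have [e1 e2] := hc _ _ Sx Sy cxy; have [hn _ bn] := hu n.
    apply: le_trans ke; rewrite mulrDl.
    have -> : X n x - X n y = 'd (u n) (phi x) (V x - V y) +
        ('d (u n) (phi x) (V y) - 'd (u n) (phi y) (V y)).
      by rewrite linearB addrA subrK.
    apply: le_trans (nrmD _ _) _; apply: lerD.
      apply: le_trans (bloch_diff_le _ M0 bn Sx.2 d1) _.
      by apply: ler_wpM2l => //; exact: ltW.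
    apply: le_trans (bloch_diff_lip _ M0 hn bn Sx.2 Sy.2 d1) _.
    rewrite -[leRHS]mulrA [D * e]mulrC -[leLHS]mulrA.
    apply: ler_wpM2l; first by rewrite divr_ge0 ?sqr_ge0 ?mulr_ge0.
    by apply: ler_pM; rewrite ?nrm_ge0 //; [exact: ltW|exact: hD].
  apply: filterS UT => n hn z z1; rewrite XYE //.
  have [zd|zd] := leP (nrm (phi z)) d.
    have Sz : S d z by [].
    have [Sr cr] := hr (c z) z Sz erefl.
    have a1 := lipX n _ _ Sz Sr (esym cr).
    (* The oscillation bound is uniform in the index, hence inherited by the limit [Y]. *)
    have a2 : nrm (Y (r (c z)) - Y z) <= s / 3.
      apply: (ulim_le FU _ (ulimB FU (limX _ Sr.1) (limX z z1))) => m.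
      exact: lipX.
    have a3 := hn _ Sr.
    have := nrm_triB (X n z) (X n (r (c z))) (Y z).
    have := nrm_triB (X n (r (c z))) (Y (r (c z))) (Y z).
    lra.
  have Xb m : nrm (X m z) <= s / 2.
    have [hm _ bm] := hu m; apply: le_trans (hd z z1 zd _ _ M0 hm bm) _.
    have -> : M * (346 * (s / (692 * (M + 1)))) = s / 2 * (M / (M + 1)) by field; lra.
    by rewrite ler_piMr //; [lra|rewrite ler_pdivrMr; lra].
  have := nrmB (X n z) (Y z); have := Xb n.
  have := ulim_le FU Xb (limX z z1); lra.
move=> e e0.
(* The factor 548 is the cost of passing from the radial derivative to the seminorm; seminorm and
   value at 0 then take [e / 3] each. *)
have s0 : 0 < e / 3 / 548 by lra.
have e3 : 0 < e / 3 by lra.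
have z1 : nrm (0 : E) < 1 by rewrite nrm0.
apply: filterS (filterI (radial _ s0) (limg 0 z1 _ e3)) => n [/= h1 h2].
apply: (@bloch_norm_lt _ _ _ (e / 3) (e / 3)); [exact: ltW|exact: ltW| |lra].
have -> : e / 3 = 548 * (e / 3 / 548) by field.
apply: bloch_of_radial; last exact: h1.
by move=> z zz1; exact: (differentiableB (hh n z zz1) (hg z zz1)).
Qed.

End Composition.

(** * Compactness of the composition operator *)

Lemma sqrtC_real (R : realType) (t : R) : 0 <= t ->
  sqrtC (t%:C%C : (R[i])%C) = (Num.sqrt t)%:C%C.
Proof.
move=> t0; rewrite -[in LHS](sqr_sqrtr t0) rmorphXn sqrCK //.
by rewrite lecR sqrtr_ge0.
Qed.

Theorem theorem4p13 (R : realType) (E : completeNormedModType (R[i])%C)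
  (ip : E -> E -> (R[i])%C) (Hip : is_inner_product ip) (phi : E -> E)
  (Hmaps : forall z, z \in unit_ball E -> phi z \in unit_ball E)
  (Han : forall z, z \in unit_ball E -> differentiable phi z)
  (Hi : forall delta : R, 0 < delta < 1 ->
     compact (closure [set phi z | z in
        [set z | z \in unit_ball E /\ `|phi z| <= delta%:C%C]]) /\
     compact (closure [set (1 - `|z| ^+ 2) *: 'd phi z z | z in
        [set z | z \in unit_ball E /\ `|phi z| <= delta%:C%C]]))
  (Hii : forall eps : R, 0 < eps -> exists r : R, r < 1 /\
     forall z, z \in unit_ball E -> r%:C%C < `|phi z| ->
       (1 - `|z| ^+ 2) * `|'d phi z z| / sqrtC (1 - `|phi z| ^+ 2) < eps%:C%C)
  (Hiii : forall eps : R, 0 < eps -> exists r : R, r < 1 /\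
     forall z, z \in unit_ball E -> r%:C%C < `|phi z| ->
       (1 - `|z| ^+ 2) * `|ip (phi z) ('d phi z z)| / (1 - `|phi z| ^+ 2)
         < eps%:C%C) :
  compact_composition_operator phi.
Proof.
have phi1 z : nrm z < 1 -> nrm (phi z) < 1.
  by have := Hmaps z; rewrite !in_unit_ball.
have dphi z : nrm z < 1 -> differentiable phi z.
  by have := Han z; rewrite in_unit_ball.
have V1 (z : E) : (1 - `|z| ^+ 2 : (R[i])%C) = (1 - nrm z ^+ 2)%:C%C.
  by rewrite nrmE rmorphB rmorphXn rmorph1.
have SE (delta : R) : [set z | z \in unit_ball E /\ `|phi z| <= delta%:C%C] =
    [set z | nrm z < 1 /\ nrm (phi z) <= delta].
  by apply/seteqP; split=> z /=; rewrite in_unit_ball nrmE lecR.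
have inner (delta : R) : 0 < delta < 1 ->
    compact (closure [set phi z | z in [set z | nrm z < 1 /\ nrm (phi z) <= delta]]) /\
    compact (closure [set (1 - `|z| ^+ 2) *: 'd phi z z | z in
      [set z | nrm z < 1 /\ nrm (phi z) <= delta]]).
  by rewrite -SE; apply: Hi.
have outer (e : R) : 0 < e -> exists2 r : R, r < 1 &
    forall z, nrm z < 1 -> r < nrm (phi z) ->
    nrm ((1 - `|z| ^+ 2) *: 'd phi z z) / Num.sqrt (1 - nrm (phi z) ^+ 2) < e /\
    nrm (ip ((1 - `|z| ^+ 2) *: 'd phi z z) (phi z)) / (1 - nrm (phi z) ^+ 2) < e.
  move=> e0; have [r2 [r21 h2]] := Hii e e0; have [r3 [r31 h3]] := Hiii e e0.
  exists (Num.max r2 r3); first by rewrite gt_max r21.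
  move=> z z1; rewrite gt_max => /andP[zr2 zr3].
  have z1' : z \in unit_ball E by rewrite in_unit_ball.
  have c0 := ltW (subr_sqr_gt0 z1); have p0 := ltW (subr_sqr_gt0 (phi1 z z1)).
  have := h2 z z1'; have := h3 z z1'; rewrite !V1 sqrtC_real // !nrmE !ltcR.
  rewrite -!rmorphM -!fmorphV -!rmorphM !ltcR => k3 k2.
  by rewrite (ipZl Hip) nrmM nrmZ nrmP // (nrm_ipC Hip); split; [exact: k2|exact: k3].
split=> [f /in_blochP[hf [K K0 fK]]|u M hu].
  have [k k0 hk] := comp_bloch Hip phi1 dphi inner outer.
  apply/in_blochP; split; first exact: comp_hol.
  by exists (k * K); [exact: mulr_ge0|exact: hk].
have uP n : [/\ 0 <= M, hol (u n), nrm (u n 0) <= M & bloch_le (u n) M].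
  by have [/in_blochP[hn _] /bloch_norm_bound[? ? ?]] := hu n.
have M0 : 0 <= M by have [] := uP 0%N.
(* An ultrafilter refining the cofinite filter contains every tail, so each of its members has
   arbitrarily large elements; this gives increasing indices. *)
have [U [FU UF]] := ultraFilterLemma (@eventually_filter).
have UP : ProperFilter U by exact: ultra_proper.
have [|g [hg gB hU]] := comp_ulim Hip phi1 dphi inner outer FU M0 (u := u).
  by move=> n; have [] := uP n.
have pick (nm : nat * nat) : exists k, (nm.2 < k)%N /\
    (bloch_norm ((u k \o phi) - g)%R < ((2 ^+ nm.1)^-1)%:E)%E.
  have e0 : 0 < (2 ^+ nm.1)^-1 :> R by rewrite invr_gt0 exprn_gt0.
  have late : U [set k | (nm.2 < k)%N] by apply: UF; exists nm.2.+1.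
  by have [k [/= k1 k2]] := filter_ex (filterI late (hU _ e0)); exists k.
have [next hnext] := choice pick.
(* [s n] is chosen with accuracy [2 ^- n] and, for positive [n], beyond the previous index. *)
pose s := fix s n := if n is n'.+1 then next (n, s n') else next (0%N, 0%N).
exists s, g; split; first by move=> n; have [] := hnext (n.+1, s n).
split; first exact/in_blochP.
move=> e e0; have [N hN] := dyadic_small 1 e0; exists N => n Nn.
have hn : (bloch_norm ((u (s n) \o phi) - g)%R < ((2 ^+ n)^-1)%:E)%E.
  by case: n {Nn} => [|n]; [have [] := hnext (0%N, 0%N)|have [] := hnext (n.+1, s n)].
apply: lt_trans hn _; rewrite lte_fin; apply: le_lt_trans hN.
by rewrite mul1r lef_pV2 ?posrE ?exprn_gt0 // ler_weXn2l // ler1n.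
Qed.
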